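(* Let $(\Pi_{\sigma,\tau})_{\sigma\le\tau}$ be a No Free Lunch TCPP. For any $X\in L^\infty(\Omega,\mathcal F_\infty,P)$ and any probability measure $R$ equivalent to $P$ with zero penalty (i.e. $\alpha^m_{0,\infty}(R)=0$), $(\Pi_{\sigma,\infty}(X))_\sigma$ is an $R$-supermartingale process with a càdlàg modification (resp. $(-\Pi_{\sigma,\infty}(-X))_\sigma$ is an $R$-submartingale process with a càdlàg modification), and $$-\Pi_{\sigma,\infty}(-X)\le E_R(X|\mathcal F_\sigma)\le\Pi_{\sigma,\infty}(X)$$ for any stopping time $\sigma$.
   Context: Setting. $(\Omega,\mathcal F_\infty,(\mathcal F_t)_{t\in\mathbb R_+},P)$ is a filtered probability space; the filtration is right continuous and complete, and $\mathcal F_0$ is the $\sigma$-algebra generated by the $P$-null sets of $\mathcal F_\infty$. Stopping times take values in $[0,+\infty]$, and $\mathcal F_\tau=\{A\in\mathcal F_\infty : A\cap\{\tau\le t\}\in\mathcal F_t\ \forall t\in\mathbb R_+\}$. $L^\infty(\mathcal F_\tau)=L^\infty(\Omega,\mathcal F_\tau,P)$ (real valued classes); (in)equalities between elements hold $P$-a.s. A dynamic pricing procedure is a family of maps $\Pi_{\sigma,\tau}:L^\infty(\mathcal F_\tau)\to L^\infty(\mathcal F_\sigma)$, indexed by stopping times $0\le\sigma\le\tau$, such that for all $X,Y\in L^\infty(\mathcal F_\tau)$: monotonicity: $X\le Y\Rightarrow\Pi_{\sigma,\tau}(X)\le\Pi_{\sigma,\tau}(Y)$; translation invariance: $\Pi_{\sigma,\tau}(X+Z)=\Pi_{\sigma,\tau}(X)+Z$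 for all $Z\in L^\infty(\mathcal F_\sigma)$; convexity: $\Pi_{\sigma,\tau}(\lambda X+(1-\lambda)Y)\le\lambda\Pi_{\sigma,\tau}(X)+(1-\lambda)\Pi_{\sigma,\tau}(Y)$ for all $\lambda\in[0,1]$; normalization: $\Pi_{\sigma,\tau}(0)=0$. It is time-consistent if $\Pi_{\nu,\sigma}(\Pi_{\sigma,\tau}(X))=\Pi_{\nu,\tau}(X)$ for all stopping times $0\le\nu\le\sigma\le\tau$ and $X\in L^\infty(\mathcal F_\tau)$. It is continuous from below if for every increasing sequence $X_n$ in $L^\infty(\mathcal F_\tau)$ with limit $X\in L^\infty(\mathcal F_\tau)$, the increasing sequence $\Pi_{\sigma,\tau}(X_n)$ has limit $\Pi_{\sigma,\tau}(X)$. A TCPP is a time-consistent dynamic pricing procedure that is continuous from below. Minimal penalty. For a probability measure $R\ll P$, $\alpha^m_{\sigma,\tau}(R)=R\text{-}\mathrm{ess\,sup}_{X\in L^\infty(\Omega,\mathcal F_\tau,P)}\big(E_R(X|\mathcal F_\sigma)-\Pi_{\sigma,\tau}(X)\big)$. In particular $\alpha^m_{0,\infty}(R)=\sup_{X\in L^\infty(\mathcal F_\infty)}(E_R(X)-\Pi_{0,\infty}(X))$. No Free Lunch. Let $\mathcal C=\{\lambda X : \lambda\in\mathbb R_+,\ X\in L^\infty(\Omega,\mathcal F_\infty,P),\ \Pi_{0,\infty}(X)\le0\}$ and let $\overline{\mathcal C}$ be its closure in $L^\infty(\Omega,\mathcal F_\infty,P)$ for the weak* topology $\sigma(L^\infty(P),L^1(P))$.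 A TCPP has No Free Lunch if $\overline{\mathcal C}\cap L^\infty_+(\Omega,\mathcal F_\infty,P)=\{0\}$. The index $\sigma$ of the processes ranges over stopping times. *)

(* Defs.v *)
From HB Require Import structures.
From mathcomp Require Import all_boot all_order all_algebra.
From mathcomp Require Import all_classical all_reals all_analysis.
From mathcomp Require Import measurable_realfun.

Set Implicit Arguments.
Unset Strict Implicit.
Unset Printing Implicit Defensive.

Import Order.TTheory GRing.Theory Num.Theory.
Import numFieldNormedType.Exports.

Local Open Scope classical_set_scope.
Local Open Scope ring_scope.

(** * Filtrations and stopping times *)

(* The sigma-algebra F_oo is the one carried by the measurableType Omega;
   sub-sigma-algebras are sets of sets G : set (set Omega). *)

Definition measurable_wrt d (Omega : measurableType d) d' (T : measurableType d')
    (G : set (set Omega)) (f : Omega -> T) : Prop :=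
  measurable_fun [set: g_sigma_algebraType G] (f : g_sigma_algebraType G -> T).

(* Only the values F t with 0 <= t matter. *)
Record usual_filtration d (Omega : measurableType d) (R : realType)
    (P : probability Omega R) (F : R -> set (set Omega)) : Prop := {
  filtration_sigma_algebra : forall t, 0 <= t -> sigma_algebra setT (F t) ;
  filtration_measurable : forall t, 0 <= t -> F t `<=` measurable ;
  filtration_nondecreasing : forall s t, 0 <= s -> s <= t -> F s `<=` F t ;
  filtration_right_continuous :
    forall t, 0 <= t -> F t = \bigcap_(s in [set s | t < s]) F s ;
  filtration_complete : measure_is_complete P ;
  filtration_0 : F 0 = <<s [set N | measurable N /\ P N = 0%E] >> }.

Definition stopping_time d (Omega : measurableType d) (R : realType)
    (F : R -> set (set Omega)) (tau : Omega -> \bar R) : Prop :=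
  (forall w, (0 <= tau w)%E) /\
  (forall t, 0 <= t -> F t [set w | (tau w <= t%:E)%E]).

Definition stopped_sigma_algebra d (Omega : measurableType d) (R : realType)
    (F : R -> set (set Omega)) (tau : Omega -> \bar R) : set (set Omega) :=
  [set A | measurable A /\
    forall t, 0 <= t -> F t (A `&` [set w | (tau w <= t%:E)%E])].

Definition stopping_pair d (Omega : measurableType d) (R : realType)
    (F : R -> set (set Omega)) (sigma tau : Omega -> \bar R) : Prop :=
  [/\ stopping_time F sigma, stopping_time F tau &
      forall w, (sigma w <= tau w)%E].

Definition time0 {d} {Omega : measurableType d} {R : realType}
  : Omega -> \bar R := cst 0%E.
Definition timeoo {d} {Omega : measurableType d} {R : realType}
  : Omega -> \bar R := cst +oo%E.

(** * Bounded random variables *)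

(* Elements of L^p are represented by functions; (in)equalities between them
   are always taken almost everywhere. *)
Definition Linfty d (Omega : measurableType d) (R : realType)
  (P : probability Omega R) := LfunType P (leey 1%E).

Definition L1 d (Omega : measurableType d) (R : realType)
  (P : probability Omega R) := LfunType P (lexx 1%E).

(* X \in L^oo(F_tau) *)
Definition Linfty_at d (Omega : measurableType d) (R : realType)
    (P : probability Omega R) (F : R -> set (set Omega))
    (tau : Omega -> \bar R) : set (Linfty P) :=
  [set X | measurable_wrt (stopped_sigma_algebra F tau) (X : Omega -> R)].

(** * Dynamic pricing procedures *)

(* Pi sigma tau X is meaningful when sigma <= tau are stopping times and X is
   in L^oo(F_tau).  That Pi is defined on classes, i.e. compatible with
   almost sure equality, is a consequence of dpp_monotone. *)
Record dynamic_pricing_procedure d (Omega : measurableType d) (R : realType)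
    (P : probability Omega R) (F : R -> set (set Omega))
    (Pi : (Omega -> \bar R) -> (Omega -> \bar R) -> Linfty P -> Linfty P)
    : Prop := {
  dpp_Linfty : forall sigma tau, stopping_pair F sigma tau ->
    forall X, Linfty_at F tau X -> Linfty_at F sigma (Pi sigma tau X) ;
  dpp_monotone : forall sigma tau, stopping_pair F sigma tau ->
    forall X Y, Linfty_at F tau X -> Linfty_at F tau Y ->
      (\forall w \ae P, X w <= Y w) ->
      \forall w \ae P, Pi sigma tau X w <= Pi sigma tau Y w ;
  dpp_translation : forall sigma tau, stopping_pair F sigma tau ->
    forall X Z, Linfty_at F tau X -> Linfty_at F sigma Z ->
      \forall w \ae P, Pi sigma tau (X + Z) w = Pi sigma tau X w + Z w ;
  dpp_convex : forall sigma tau, stopping_pair F sigma tau ->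
    forall X Y, Linfty_at F tau X -> Linfty_at F tau Y ->
    forall l : R, 0 <= l <= 1 ->
      \forall w \ae P, Pi sigma tau (l *: X + (1 - l) *: Y) w <=
                       l * Pi sigma tau X w + (1 - l) * Pi sigma tau Y w ;
  dpp_normalized : forall sigma tau, stopping_pair F sigma tau ->
    \forall w \ae P, Pi sigma tau 0 w = 0 }.

Definition time_consistent d (Omega : measurableType d) (R : realType)
    (P : probability Omega R) (F : R -> set (set Omega))
    (Pi : (Omega -> \bar R) -> (Omega -> \bar R) -> Linfty P -> Linfty P)
    : Prop :=
  forall nu sigma tau, stopping_pair F nu sigma -> stopping_pair F sigma tau ->
  forall X, Linfty_at F tau X ->
    \forall w \ae P, Pi nu sigma (Pi sigma tau X) w = Pi nu tau X w.

Definition continuous_from_below d (Omega : measurableType d) (R : realType)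
    (P : probability Omega R) (F : R -> set (set Omega))
    (Pi : (Omega -> \bar R) -> (Omega -> \bar R) -> Linfty P -> Linfty P)
    : Prop :=
  forall sigma tau, stopping_pair F sigma tau ->
  forall (X_ : nat -> Linfty P) (X : Linfty P),
    (forall n, Linfty_at F tau (X_ n)) -> Linfty_at F tau X ->
    (forall n, \forall w \ae P, X_ n w <= X_ n.+1 w) ->
    (\forall w \ae P, X_ n w @[n --> \oo] --> X w) ->
    \forall w \ae P, Pi sigma tau (X_ n) w @[n --> \oo] --> Pi sigma tau X w.

Record TCPP d (Omega : measurableType d) (R : realType)
    (P : probability Omega R) (F : R -> set (set Omega))
    (Pi : (Omega -> \bar R) -> (Omega -> \bar R) -> Linfty P -> Linfty P)
    : Prop := {
  TCPP_dpp : dynamic_pricing_procedure F Pi ;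
  TCPP_time_consistent : time_consistent F Pi ;
  TCPP_continuous_from_below : continuous_from_below F Pi }.

(** * No Free Lunch *)

(* sigma(L^oo, L^1) is the initial topology for X |-> (g |-> E_P[X g]), with
   values in R^(L^1) equipped with the topology of pointwise convergence. *)
Definition L1_pairing d (Omega : measurableType d) (R : realType)
    (P : probability Omega R) (X : Linfty P) : {ptws (L1 P) -> R} :=
  fun g => \int[P]_(w in setT) (X w * g w).

Definition weak_star d (Omega : measurableType d) (R : realType)
    (P : probability Omega R) : topologicalType :=
  initial_topology (@L1_pairing d Omega R P).

Definition zero_cost_cone d (Omega : measurableType d) (R : realType)
    (P : probability Omega R)
    (Pi : (Omega -> \bar R) -> (Omega -> \bar R) -> Linfty P -> Linfty P)
    : set (Linfty P) :=
  [set Z | exists (l : R) (X : Linfty P),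
    [/\ 0 <= l, \forall w \ae P, Pi time0 timeoo X w <= 0 & Z = l *: X]].

Definition no_free_lunch d (Omega : measurableType d) (R : realType)
    (P : probability Omega R)
    (Pi : (Omega -> \bar R) -> (Omega -> \bar R) -> Linfty P -> Linfty P)
    : Prop :=
  forall Z : Linfty P,
    (closure (zero_cost_cone Pi : set (weak_star P)) Z /\
     \forall w \ae P, 0 <= Z w) <->
    \forall w \ae P, Z w = 0.

(** * Conditional expectation and minimal penalty *)

Definition is_cond_exp d (Omega : measurableType d) (R : realType)
    (Q : probability Omega R) (G : set (set Omega)) (X Y : Omega -> R) : Prop :=
  [/\ measurable_wrt G Y,
      Q.-integrable setT (EFin \o Y) &
      forall A, G A ->
        (\int[Q]_(w in A) (Y w)%:E = \int[Q]_(w in A) (X w)%:E)%E].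

(* A version of E_Q(X | G); one exists whenever X is Q-integrable and G is a
   sub-sigma-algebra, and any two are Q-almost surely equal. *)
Definition cond_exp d (Omega : measurableType d) (R : realType)
    (Q : probability Omega R) (G : set (set Omega)) (X : Omega -> R)
    : Omega -> R :=
  xget (cst 0) [set Y | is_cond_exp Q G X Y].

(* Essential supremum of a family of random variables (the library's ess_sup
   is the essential supremum of the values of a single function). *)
Definition is_family_ess_sup d (Omega : measurableType d) (R : realType)
    (Q : probability Omega R) (S : set (Omega -> \bar R)) (Z : Omega -> \bar R)
    : Prop :=
  [/\ measurable_fun setT Z,
      (forall f, S f -> \forall w \ae Q, (f w <= Z w)%E) &
      forall Z', measurable_fun setT Z' ->
        (forall f, S f -> \forall w \ae Q, (f w <= Z' w)%E) ->
        \forall w \ae Q, (Z w <= Z' w)%E].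

(* A version of the Q-essential supremum of the
   E_Q(X | F_sigma) - Pi_{sigma,tau}(X), for X in L^oo(F_tau).  It always
   exists; the default value +oo is irrelevant. *)
Definition minimal_penalty d (Omega : measurableType d) (R : realType)
    (P : probability Omega R) (F : R -> set (set Omega))
    (Pi : (Omega -> \bar R) -> (Omega -> \bar R) -> Linfty P -> Linfty P)
    (sigma tau : Omega -> \bar R) (Q : probability Omega R)
    : Omega -> \bar R :=
  xget (cst +oo%E) [set Z | is_family_ess_sup Q
    [set f | exists2 X : Linfty P, Linfty_at F tau X &
       f = fun w => (cond_exp Q (stopped_sigma_algebra F sigma) X w
                     - Pi sigma tau X w)%:E] Z].

Definition zero_penalty d (Omega : measurableType d) (R : realType)
    (P : probability Omega R) (F : R -> set (set Omega))
    (Pi : (Omega -> \bar R) -> (Omega -> \bar R) -> Linfty P -> Linfty P)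
    (Q : probability Omega R) : Prop :=
  \forall w \ae Q, minimal_penalty F Pi time0 timeoo Q w = 0%E.

Definition equivalent_probability d (Omega : measurableType d) (R : realType)
    (Q P : probability Omega R) : Prop :=
  Q `<< P /\ P `<< Q.

(** * Processes indexed by stopping times *)

Definition adapted_integrable d (Omega : measurableType d) (R : realType)
    (Q : probability Omega R) (F : R -> set (set Omega))
    (M : (Omega -> \bar R) -> Omega -> R) : Prop :=
  forall sigma, stopping_time F sigma ->
    measurable_wrt (stopped_sigma_algebra F sigma) (M sigma) /\
    Q.-integrable setT (EFin \o M sigma).

Definition supermartingale d (Omega : measurableType d) (R : realType)
    (Q : probability Omega R) (F : R -> set (set Omega))
    (M : (Omega -> \bar R) -> Omega -> R) : Prop :=
  adapted_integrable Q F M /\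
  forall sigma tau, stopping_pair F sigma tau ->
    \forall w \ae Q,
      cond_exp Q (stopped_sigma_algebra F sigma) (M tau) w <= M sigma w.

Definition submartingale d (Omega : measurableType d) (R : realType)
    (Q : probability Omega R) (F : R -> set (set Omega))
    (M : (Omega -> \bar R) -> Omega -> R) : Prop :=
  adapted_integrable Q F M /\
  forall sigma tau, stopping_pair F sigma tau ->
    \forall w \ae Q,
      M sigma w <= cond_exp Q (stopped_sigma_algebra F sigma) (M tau) w.

Definition cadlag (R : realType) (f : R -> R) : Prop :=
  (forall t, 0 <= t -> f @ t^'+ --> f t) /\
  (forall t, 0 < t -> cvg (f @ t^'-)).

(* Y t is indexed by t in [0,+oo], as stopping times may take the value +oo;
   the path regularity concerns the times t in R_+. *)
Definition has_cadlag_modification d (Omega : measurableType d) (R : realType)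
    (P : probability Omega R) (F : R -> set (set Omega))
    (M : (Omega -> \bar R) -> Omega -> R) : Prop :=
  exists Y : \bar R -> Omega -> R,
    [/\ forall w, cadlag (fun t => Y t%:E w),
        forall t, (0 <= t)%E ->
          measurable_wrt (stopped_sigma_algebra F (cst t)) (Y t) &
        forall sigma, stopping_time F sigma ->
          \forall w \ae P, M sigma w = Y (sigma w) w].

(* Main.v *)
From HB Require Import structures.
Require Import Defs.
From mathcomp Require Import all_boot all_order all_algebra.
From mathcomp Require Import all_classical all_reals all_analysis.
From mathcomp Require Import measurable_realfun ess_sup_inf.
From mathcomp Require Import lra.

Set Implicit Arguments.
Unset Strict Implicit.
Unset Printing Implicit Defensive.

Import Order.TTheory GRing.Theory Num.Theory.
Import numFieldNormedType.Exports.

Local Open Scope classical_set_scope.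
Local Open Scope ring_scope.


(** Write M_sigma for the price Pi sigma timeoo X.

    Order.  Since a minimal penalty that vanishes Q-almost surely is an
    essential supremum of the E_Q(X|F_0) - Pi_0(X), zero penalty gives
    E_Q(X) <= E_Q(Pi_0(X)) for every X.  Prices are local: on an event A known at
    time sigma, only the restriction of a claim to A matters (price_local).
    The claim 1_A (X - M_sigma) therefore costs nothing at time sigma, hence
    nothing at time 0 by time consistency, and its Q-expectation is
    nonpositive: the integral of X over A is at most that of M_sigma
    (zero_penalty_integral).  Letting A vary gives E_Q(X|F_sigma) <= M_sigma,
    and applying this to M_tau instead of X gives the supermartingale
    property, because M_tau and X have the same price at time sigma.  The
    lower bound and the submartingale are the same facts for - X.

    Regularity.  Doob's upcrossing inequality shows that almost every path of
    t |-> M_t, restricted to the dyadic times, crosses each rational interval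
    finitely often.  Such a path has one-sided limits along the dyadics, and
    its right limits form a cadlag path Y (cadlag_right_limits).  A stopping
    time sigma is the limit of the dyadic stopping times sigma_n > sigma, and
    M_(sigma_n) is read off the dyadic path since prices at two stopping times
    coincide where the stopping times do (price_eq_where_equal); hence
    M_(sigma_n) converges to Y_sigma.

    It remains to see that M_sigma = Y_sigma.  The inequality
    Y_sigma <= M_sigma follows from the supermartingale property and dominated
    convergence.  The converse (price_le_limit) is where continuity from below
    enters.  Fix e > 0, let A_n be the event that M_(sigma_k) <= Y_sigma + e for
    all k >= n, and let X_n be X on A_n and - c outside A_n, where - c is a lower
    bound of both X and Y_sigma.
    As A_n is contained in an event of F_(sigma_n) on which
    M_(sigma_n) <= Y_sigma + e, locality at time sigma_n shows that the price of
    X_n at time sigma_n, and so its price at time sigma, is at most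
    Y_sigma + e.  Since X_n increases to X, so is the price of X. *)

(** * Upcrossings of a finite sequence *)

(** The number of times that a greedy trader, buying at or below a and selling
    at or above b, completes a trade; [holding] tells whether a purchase is
    pending. *)
Fixpoint upcross (R : realType) (a b : R) (holding : bool) (s : seq R) : nat :=
  if s is x :: s' then
    if holding then if b <= x then (upcross a b false s').+1
                    else upcross a b true s'
    else upcross a b (x <= a) s'
  else 0.

Section upcross_lemmas.
Context (R : realType) (a b : R).

(** The traders with and without a pending purchase act alike from the first
    purchase or sale on, so one sale is all that can separate them. *)
Lemma upcross_false_true s :
  (upcross a b false s <= upcross a b true s <= (upcross a b false s).+1)%N.
Proof.
elim: s => //= x s /andP[h1 h2].
by case: (b <= x); case: (x <= a); rewrite ?ltnS ?h1 ?h2 ?leqnn ?leqnSn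
  ?(leq_trans h2) //=.
Qed.

(** Greed is optimal, so a finer observation of a path can only reveal more
    upcrossings; this makes the count monotone along an increasing sequence of
    time grids. *)
Lemma subseq_upcross h s1 s2 : subseq s1 s2 ->
  (upcross a b h s1 <= upcross a b h s2)%N.
Proof.
elim: s2 h s1 => [|x s2 IH] h [|y s1] //=.
case: (y =P x) => [-> /IH sub|_ sub].
  by case: h => //; case: (b <= x); rewrite ?ltnS.
have /andP[h1 h2] := upcross_false_true s2.
apply: (leq_trans (IH h _ sub)).
by case: h {sub}; [case: (b <= x)|case: (x <= a)].
Qed.

End upcross_lemmas.

(** * Paths with finitely many upcrossings along a dense set of times *)

(** Rational levels suffice to separate two cluster values of a path, and keep
    the exceptional null set of a random path a countable union. *)
Definition bounded_upcross (R : realType) (D : set R) (x : R -> R) : Prop :=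
  forall a b : rat, a < b -> exists K : nat, forall s,
    sorted <%R s -> {in s, forall t, D t} ->
    (upcross (ratr a) (ratr b) false (map x s) <= K)%N.

Section paths.
Context (R : realType).

(** The limit is the supremum of the levels y such that eventually y < x. *)
Lemma cvg_no_oscillation (T : Type) (F : set_system T) {FF : ProperFilter F}
    (x : T -> R) (c : R) :
  (forall t, `|x t| <= c) ->
  (forall a b : rat, a < b ->
    (\forall t \near F, ratr a < x t) \/ (\forall t \near F, x t < ratr b)) ->
  cvg (x @ F).
Proof.
move=> xc osc; pose E : set R := [set y | \forall t \near F, y < x t].
have Em y : E (- c - 1 + y) -> y <= 2 * c + 1.
  move=> Ey; have [t /=] := filter_ex Ey; have := xc t.
  rewrite ler_norml => /andP[_ ?] ?; lra.
have supE : has_sup E.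
  split; first by exists (- c - 1); apply: nearW => t; have := xc t;
    rewrite ler_norml => /andP[? _]; lra.
  exists c => y Ey; have [t /=] := filter_ex Ey; have := xc t.
  rewrite ler_norml => /andP[_ ?] ?; lra.
apply/cvg_ex; exists (sup E); apply/cvgrPdist_lt => e e0.
have [y Ey yE] := sup_adherent e0 supE.
have e2 : 0 < e / 2 by lra.
have [a] := @rat_in_itvoo R (sup E) (sup E + e / 2) ltac:(lra).
rewrite in_itv /= => /andP[a1 a2].
have [b] := @rat_in_itvoo R (sup E + e / 2) (sup E + e) ltac:(lra).
rewrite in_itv /= => /andP[b1 b2].
have ab : a < b by rewrite -(ltr_rat R) (lt_trans a2).
case: (osc a b ab) => [Ea|Eb].
  by have := ub_le_sup (supE.2) Ea; rewrite leNgt a1.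
near=> t.
have yt : y < x t by near: t; exact: Ey.
have tb : x t < ratr b by near: t; exact: Eb.
rewrite ltr_norml; apply/andP; split; lra.
Unshelve. all: by end_near. Qed.

Context (D : set R) (x : R -> R) (c : R).
Hypothesis dense_D : forall u v : R, 0 <= u -> u < v ->
  exists2 s, D s & u < s < v.
Hypothesis xc : forall t, `|x t| <= c.
Hypothesis up_x : bounded_upcross D x.


Lemma within_right_proper t : 0 <= t -> ProperFilter (within D t^'+).
Proof.
move=> t0; apply: Build_ProperFilter_ex => P [e /= e0 eP].
have [s Ds /andP[ts se]] := @dense_D t (t + e) t0 ltac:(lra).
exists s; apply: (eP s) => //=.
by rewrite ltr_norml; apply/andP; split; lra.
Qed.

Lemma within_left_proper t : 0 < t -> ProperFilter (within D t^'-).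
Proof.
move=> t0; apply: Build_ProperFilter_ex => P [e /= e0 eP].
have [s Ds /andP[ts se]] := @dense_D (Num.max 0 (t - e)) t
  ltac:(by rewrite le_max lexx) ltac:(by rewrite gt_max t0 /=; lra).
exists s; apply: (eP s) => //=.
move: ts; rewrite gt_max => /andP[? ?].
by rewrite ltr_norml; apply/andP; split; lra.
Qed.

(** A path that is frequently below a and frequently above b to the right of t
    has arbitrarily many upcrossings: each new one is inserted between t and
    the earliest time chosen so far. *)
Lemma upcross_right a b t :
  (forall u, t < u -> exists s, [/\ D s, t < s < u & x s <= a]) ->
  (forall u, t < u -> exists s, [/\ D s, t < s < u & b <= x s]) ->
  forall k : nat, exists s, [/\ sorted <%R s, {in s, forall r, D r /\ t < r} &
    (k <= upcross a b false (map x s))%N].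
Proof.
move=> lo hi; elim=> [|k [s [ss sD sk]]]; first by exists [::].
pose u := head (t + 1) s.
have tu : t < u.
  rewrite /u; case: (s) sD => [|y s'] sD /=; first by lra.
  by have [] := sD y (mem_head _ _).
have [v [Dv /andP[tv vu] bv]] := hi u tu.
have [w [Dw /andP[tw wv] wa]] := lo v tv.
exists [:: w, v & s]; split.
- rewrite /= wv /=; move: vu; rewrite /u.
  by case: (s) ss => //= y s' -> ->.
- by move=> r; rewrite !inE => /or3P[/eqP->|/eqP->|/sD].
- by rewrite /= wa bv.
Qed.

(** On the left of t the upcrossings are built in chronological order, whence
    the moving lower bound u in the induction. *)
Lemma upcross_left a b t :
  (forall u, u < t -> exists s, [/\ D s, u < s < t & x s <= a]) ->
  (forall u, u < t -> exists s, [/\ D s, u < s < t & b <= x s]) ->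
  forall (k : nat) u, u < t -> exists s,
    [/\ path <%R u s, {in s, forall r, D r} &
    (k <= upcross a b false (map x s))%N].
Proof.
move=> lo hi; elim=> [|k IH] u ut; first by exists [::].
have [w [Dw /andP[uw wt] wa]] := lo u ut.
have [v [Dv /andP[wv vt] bv]] := hi w wt.
have [s [ss sD sk]] := IH v vt.
exists [:: w, v & s]; split.
- by rewrite /= uw wv.
- by move=> r; rewrite !inE => /or3P[/eqP->|/eqP->|/sD].
- by rewrite /= wa bv.
Qed.

Lemma not_near_right t (P : R -> Prop) : ~ (\forall s \near within D t^'+, P s) ->
  forall u, t < u -> exists s, [/\ D s, t < s < u & ~ P s].
Proof.
move=> nP u tu; apply: contrapT => nex; apply: nP.
have : \forall s \near t^'+, s < u by exact: nbhs_right_lt.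
have : \forall s \near t^'+, t < s by exact: nbhs_right_gt.
apply: filterS2 => s ts su Ds; apply: contrapT => nPs.
by apply: nex; exists s; split => //; rewrite ts su.
Qed.

Lemma not_near_left t (P : R -> Prop) : ~ (\forall s \near within D t^'-, P s) ->
  forall u, u < t -> exists s, [/\ D s, u < s < t & ~ P s].
Proof.
move=> nP u tu; apply: contrapT => nex; apply: nP.
have : \forall s \near t^'-, u < s by exact: nbhs_left_gt.
have : \forall s \near t^'-, s < t by exact: nbhs_left_lt.
apply: filterS2 => s ts su Ds; apply: contrapT => nPs.
by apply: nex; exists s; split => //; rewrite ts su.
Qed.

Lemma cvg_within_right t : 0 <= t -> cvg (x @ within D t^'+).
Proof.
move=> t0; have FF := within_right_proper t0.
apply: cvg_no_oscillation xc _ => a b ab; apply: contrapT => /not_orP[na nb].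
have [K up] := up_x ab.
have [||s [ss sD]] := @upcross_right (ratr a) (ratr b) t _ _ K.+1.
- move=> u /(not_near_right na)[s [Ds tsu /negP]]; rewrite -leNgt => xs.
  by exists s.
- move=> u /(not_near_right nb)[s [Ds tsu /negP]]; rewrite -leNgt => xs.
  by exists s.
by rewrite ltnNge up// => r /sD[].
Qed.

Lemma cvg_within_left t : 0 < t -> cvg (x @ within D t^'-).
Proof.
move=> t0; have FF := within_left_proper t0.
apply: cvg_no_oscillation xc _ => a b ab; apply: contrapT => /not_orP[na nb].
have [K up] := up_x ab.
have [|||s [ss sD]] := @upcross_left (ratr a) (ratr b) t _ _ K.+1 0.
- move=> u /(not_near_left na)[s [Ds tsu /negP]]; rewrite -leNgt => xs.
  by exists s.
- move=> u /(not_near_left nb)[s [Ds tsu /negP]]; rewrite -leNgt => xs.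
  by exists s.
- exact: t0.
by rewrite ltnNge up//; exact: path_sorted ss.
Qed.

(** The values of the right-limit path near t are limits of values of x at
    points of D near t and on the same side of t, so they inherit the one-sided
    limits of x along D. *)
Lemma cadlag_right_limits : cadlag (fun t => lim (x @ within D t^'+)).
Proof.
split=> t t0.
  have FF := within_right_proper t0.
  have /cvgrPdist_lt cv := cvg_within_right t0.
  apply/cvgrPdist_le => e e0.
  have [d /= d0 dP] := cv e e0.
  have : \forall u \near t^'+, u < t + d by apply: nbhs_right_lt; lra.
  have : \forall u \near t^'+, t < u by exact: nbhs_right_gt.
  apply: filterS2 => u tu ud.
  have u0 : 0 <= u by lra.
  have GG := within_right_proper u0.
  have cvu := cvg_within_right u0.
  have xe : \forall s \near within D u^'+,
      `|lim (x @ within D t^'+) - x s| < e.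
    have : \forall s \near u^'+, s < t + d by exact: nbhs_right_lt.
    have : \forall s \near u^'+, u < s by exact: nbhs_right_gt.
    apply: filterS2 => s us sd Ds; apply: dP => //=; last by lra.
    by rewrite ltr_norml; apply/andP; split; lra.
  rewrite ler_distl; apply/andP; split.
    rewrite lerBlDr; apply: limr_le => //.
    by apply: filterS xe => s; rewrite ltr_norml => /andP[? ?]; lra.
  rewrite -lerBlDr; apply: limr_ge => //.
  by apply: filterS xe => s; rewrite ltr_norml => /andP[? ?]; lra.
have FF := within_left_proper t0.
have /cvg_ex[/= l /cvgrPdist_lt cv] := cvg_within_left t0.
apply/cvg_ex; exists l; apply/cvgrPdist_le => e e0.
have [d /= d0 dP] := cv e e0.
have : \forall u \near t^'-, Num.max 0 (t - d) < u.
  by apply: nbhs_left_gt; rewrite gt_max t0 /=; lra.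
have : \forall u \near t^'-, u < t by exact: nbhs_left_lt.
apply: filterS2 => u ut; rewrite gt_max => /andP[u0 ud].
have GG := within_right_proper (ltW u0).
have cvu := cvg_within_right (ltW u0).
have xe : \forall s \near within D u^'+, `|l - x s| < e.
  have : \forall s \near u^'+, s < t by exact: nbhs_right_lt.
  have : \forall s \near u^'+, u < s by exact: nbhs_right_gt.
  apply: filterS2 => s us sd Ds; apply: dP => //=.
  by rewrite ltr_norml; apply/andP; split; lra.
rewrite ler_distl; apply/andP; split.
  rewrite lerBlDr; apply: limr_le => //.
  by apply: filterS xe => s; rewrite ltr_norml => /andP[? ?]; lra.
rewrite -lerBlDr; apply: limr_ge => //.
by apply: filterS xe => s; rewrite ltr_norml => /andP[? ?]; lra.
Qed.
End paths.

(** * Sub-sigma-algebras *)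

Section sub_sigma_algebra.
Context d (Omega : measurableType d) (R : realType) (G : set (set Omega)).
Hypothesis hG : sigma_algebra setT G.

Lemma sigma_algebra_setC A : G A -> G (~` A).
Proof. by case: hG => _ GC _ /GC; rewrite setTD. Qed.

Lemma sigma_algebra_setT : G setT.
Proof. by rewrite -setC0; apply: sigma_algebra_setC; case: hG. Qed.

Lemma sigma_algebra_bigcup (A : nat -> set Omega) :
  (forall n, G (A n)) -> G (\bigcup_n A n).
Proof. by case: hG => _ _; apply. Qed.

Lemma sigma_algebra_setU A B : G A -> G B -> G (A `|` B).
Proof.
by move=> GA GB; rewrite -bigcup2E; apply: sigma_algebra_bigcup => -[|[|n]] //=;
  case: hG.
Qed.

Lemma sigma_algebra_setI A B : G A -> G B -> G (A `&` B).
Proof.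
move=> GA GB; rewrite -(setCK (A `&` B)) setCI.
by apply: sigma_algebra_setC; apply: sigma_algebra_setU;
  exact: sigma_algebra_setC.
Qed.

Lemma sigma_algebra_setD A B : G A -> G B -> G (A `\` B).
Proof.
by move=> GA GB; rewrite setDE; apply: sigma_algebra_setI => //;
  exact: sigma_algebra_setC.
Qed.

Lemma measurable_wrtP d' (T : measurableType d') (f : Omega -> T) :
  measurable_wrt G f <-> forall B, measurable B -> G (f @^-1` B).
Proof.
split=> [mf B mB|mf _ B mB].
  have := mf measurableT B mB.
  by rewrite setTI (measurable_g_measurableTypeE hG).
by rewrite setTI (measurable_g_measurableTypeE hG); exact: mf.
Qed.

Hypothesis Gm : G `<=` measurable.

Lemma measurable_wrt_measurable d' (T : measurableType d') (f : Omega -> T) :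
  measurable_wrt G f -> measurable_fun setT f.
Proof.
by move=> /measurable_wrtP mf _ B mB; rewrite setTI; apply: Gm; exact: mf.
Qed.

Lemma measurable_wrt_patch (A : set Omega) (f g : Omega -> R) :
  G A -> measurable_wrt G g -> {in A, f =1 g} ->
  (forall w, ~ A w -> f w = 0) -> measurable_wrt G f.
Proof.
move=> GA /measurable_wrtP mg fg f0; apply/measurable_wrtP => B mB.
have -> : f @^-1` B = (A `&` g @^-1` B) `|` (~` A `&` (cst 0 @^-1` B)).
  apply/seteqP; split=> w /=.
    have [Aw|Aw] := pselect (A w); first by rewrite fg ?inE//; left.
    by rewrite f0//; right.
  by case=> -[Aw]; [rewrite fg ?inE|rewrite f0].
apply: sigma_algebra_setU; apply: sigma_algebra_setI => //; first exact: mg.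
  exact: sigma_algebra_setC.
rewrite preimage_cst; case: ifP => _; last by case: hG.
exact: sigma_algebra_setT.
Qed.

Context (P : probability Omega R).
Hypothesis Gnull : forall N, P.-negligible N -> G N.

(** When G contains the null sets, modifying a function on a null set does not
    affect its measurability. *)
Lemma measurable_wrt_ae (f g : Omega -> R) : measurable_wrt G f ->
  (\forall w \ae P, f w = g w) -> measurable_wrt G g.
Proof.
move=> /measurable_wrtP mf fg; apply/measurable_wrtP => B mB.
pose N := ~` [set w | f w = g w].
have GN A : A `<=` N -> G A.
  by move=> AN; apply: Gnull; apply: negligibleS fg.
have -> : g @^-1` B = (f @^-1` B `\` (f @^-1` B `&` N)) `|` (g @^-1` B `&` N).
  apply/seteqP; split=> w /=.
    move=> gB; have [e|e] := pselect (f w = g w); last by right.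
    by left; rewrite e; split=> // -[].
  by case=> [[fB h]|[]//]; have [<-//|e] := pselect (f w = g w); case: h.
apply: sigma_algebra_setU.
  by apply: sigma_algebra_setD; [exact: mf|apply: GN; exact: subIsetr].
by apply: GN; exact: subIsetr.
Qed.

Lemma measurable_wrt_cvg (f_ : nat -> Omega -> R) (f : Omega -> R) :
  (forall n, measurable_wrt G (f_ n)) ->
  (\forall w \ae P, f_ n w @[n --> \oo] --> f w) -> measurable_wrt G f.
Proof.
move=> mf cv; pose C := [set w | f_ n w @[n --> \oo] --> f w].
have GC : G C by rewrite -(setCK C); apply/sigma_algebra_setC/Gnull.
apply: (@measurable_wrt_ae (f \* \1_C)); last first.
  by apply: filterS cv => w Cw /=; rewrite indicE mem_set// mulr1.
apply: (@measurable_fun_cvg _ (g_sigma_algebraType G) _ _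
  (fun n => f_ n \* \1_C)).
  move=> n; apply: (@measurable_wrt_patch C _ (f_ n)) => //.
    by move=> w wC; rewrite /= indicE wC mulr1.
  by move=> w nC; rewrite /= indicE memNset// mulr0.
move=> w _ /=; rewrite indicE; case: (boolP (w \in C)) => [/set_mem Cw|_].
  by under eq_cvg do rewrite mulr1; rewrite mulr1.
by under eq_cvg do rewrite mulr0; rewrite mulr0; exact: cvg_cst.
Qed.

End sub_sigma_algebra.

Lemma measurable_wrt_sub d (Omega : measurableType d) d' (T : measurableType d')
    (G H : set (set Omega)) (f : Omega -> T) :
  sigma_algebra setT G -> sigma_algebra setT H -> G `<=` H ->
  measurable_wrt G f -> measurable_wrt H f.
Proof.
move=> hG hH GH /(measurable_wrtP hG) mf; apply/(measurable_wrtP hH) => B mB.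
exact/GH/mf.
Qed.

(** * Stopping times *)

Section stopping_times.
Context d (Omega : measurableType d) (R : realType) (P : probability Omega R).
Context (F : R -> set (set Omega)) (hF : usual_filtration P F).
Implicit Types (sigma tau : Omega -> \bar R) (s t : R) (A : set Omega).

Let FS t : 0 <= t -> sigma_algebra setT (F t).
Proof. exact: filtration_sigma_algebra hF _. Qed.

Lemma filtration_null t N : 0 <= t -> P.-negligible N -> F t N.
Proof.
move=> t0 nN; have mN := filtration_complete hF nN.
apply: (filtration_nondecreasing hF (lexx 0) t0).
rewrite (filtration_0 hF); apply: sub_gen_smallest; split => //.
exact: measure_negligible.
Qed.

Lemma stopped_sigma_algebraP tau : stopping_time F tau ->
  sigma_algebra setT (stopped_sigma_algebra F tau).
Proof.
move=> [tau0 tauF]; split.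
- by split=> // t t0; rewrite set0I; case: (FS t0).
- move=> A [mA FA]; rewrite setTD; split; first exact: measurableC.
  move=> t t0; rewrite (_ : _ `&` _ = [set w | (tau w <= t%:E)%E] `\`
    (A `&` [set w | (tau w <= t%:E)%E])).
    by apply: (sigma_algebra_setD (FS t0)); [exact: tauF|exact: FA].
  by apply/seteqP; split=> w /=; tauto.
- move=> A GA; split; first by apply: bigcup_measurable => n _; case: (GA n).
  move=> t t0; rewrite setI_bigcupl; apply: (sigma_algebra_bigcup (FS t0)) => n.
  by case: (GA n) => _; exact.
Qed.

Lemma stopped_measurable tau : stopped_sigma_algebra F tau `<=` measurable.
Proof. by move=> A []. Qed.

Lemma stopped_null tau N : P.-negligible N -> stopped_sigma_algebra F tau N.
Proof.
move=> nN; split; first exact: (filtration_complete hF).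
by move=> t t0; apply: filtration_null => //; apply: negligibleS nN.
Qed.

Lemma stopped_nondecreasing sigma tau : stopping_pair F sigma tau ->
  stopped_sigma_algebra F sigma `<=` stopped_sigma_algebra F tau.
Proof.
move=> [_ [_ tauF] st] A [mA FA]; split=> // t t0.
rewrite (_ : _ `&` _ = (A `&` [set w | (sigma w <= t%:E)%E]) `&`
  [set w | (tau w <= t%:E)%E]).
  by apply: (sigma_algebra_setI (FS t0)); [exact: FA|exact: tauF].
apply/seteqP; split=> w /=; last tauto.
by move=> [Aw tw]; split=> //; split=> //; exact: le_trans (st w) tw.
Qed.

Lemma stopping_time_cst (t : \bar R) : (0 <= t)%E -> stopping_time F (cst t).
Proof.
move=> t0; split=> // s s0 /=; have [ts|ts] := boolP (t <= s%:E)%E.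
  rewrite (_ : [set _ | _] = setT); first exact: sigma_algebra_setT (FS s0).
  by apply/seteqP; split.
rewrite (_ : [set _ | _] = set0); first by case: (FS s0).
by apply/seteqP; split.
Qed.

Lemma stopping_pair_time0 tau : stopping_time F tau ->
  stopping_pair F time0 tau.
Proof.
by move=> st; split=> //; [exact: stopping_time_cst|case: st].
Qed.

Lemma stopping_pair_timeoo tau : stopping_time F tau ->
  stopping_pair F tau timeoo.
Proof.
by move=> st; split=> // [|w]; [exact: stopping_time_cst|exact: leey].
Qed.

Lemma stopped_timeoo : stopped_sigma_algebra F timeoo = measurable.
Proof.
apply/seteqP; split=> [A []//|A mA]; split=> // t t0.
rewrite (_ : _ `&` _ = set0); first by case: (FS t0).
by apply/seteqP; split=> // w [_] /=; rewrite leNgt ltry.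
Qed.

Lemma stopped_cst t : 0 <= t -> F t `<=` stopped_sigma_algebra F (cst t%:E).
Proof.
move=> t0 A FA; split; first exact: (filtration_measurable hF t0).
move=> s s0 /=; have [ts|ts] := boolP (t%:E <= s%:E :> \bar R)%E.
  rewrite (_ : [set _ | _] = setT) ?setIT; last by apply/seteqP; split.
  exact: (filtration_nondecreasing hF t0 ts).
rewrite (_ : [set _ | _] = set0) ?setI0; last by apply/seteqP; split.
by case: (FS s0).
Qed.

Lemma stopped_cst_sub t : 0 <= t -> stopped_sigma_algebra F (cst t%:E) `<=` F t.
Proof.
move=> t0 A [_ /(_ t t0)] /=.
by rewrite (_ : [set _ | _] = setT) ?setIT//; apply/seteqP; split=> // w _ /=.
Qed.

Lemma stopping_time_min sigma tau : stopping_time F sigma ->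
  stopping_time F tau -> stopping_time F (fun w => Order.min (sigma w) (tau w)).
Proof.
move=> [s0 sF] [t0 tF]; split=> [w|t tt]; first by rewrite le_min s0 t0.
rewrite (_ : [set _ | _] = [set w | (sigma w <= t%:E)%E] `|`
  [set w | (tau w <= t%:E)%E]).
  by apply: (sigma_algebra_setU (FS tt)); [exact: sF|exact: tF].
by apply/seteqP; split=> w /=; rewrite ge_min => /orP.
Qed.

(** If sigma < tau, some rational r satisfies sigma <= r < tau; removing these
    countably many events from {tau <= t} shows that {sigma = tau <= t} is
    already known at time t. *)
Lemma stopped_setI_eq sigma tau A : stopping_pair F sigma tau ->
  stopped_sigma_algebra F tau A ->
  stopped_sigma_algebra F sigma (A `&` [set w | sigma w = tau w]).
Proof.
move=> [[s0 sF] [t0 tF] st] [mA FA].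
have eqF t : 0 <= t ->
    F t ([set w | (tau w <= t%:E)%E] `&` [set w | sigma w = tau w]).
  move=> t0'.
  (* an enumeration of the rationals, clipped to [0, t] *)
  pose q (n : nat) : R :=
    Num.min t (Num.max 0 (ratr (odflt 0 (unpickle n : option rat)))).
  have q0 n : 0 <= q n by rewrite le_min t0' le_max lexx.
  rewrite (_ : _ `&` _ = [set w | (tau w <= t%:E)%E] `\` \bigcup_n
     ([set w | (sigma w <= (q n)%:E)%E] `\` [set w | (tau w <= (q n)%:E)%E])).
    apply: (sigma_algebra_setD (FS t0')); first exact: tF.
    apply: (sigma_algebra_bigcup (FS t0')) => n.
    have qt : q n <= t by rewrite ge_min lexx.
    by apply: (sigma_algebra_setD (FS t0'));
      apply: (filtration_nondecreasing hF (q0 n) qt); [exact: sF|exact: tF].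
  apply/seteqP; split=> w /= [tw e]; split=> //.
    by move=> [n _] /= []; rewrite e.
  apply: contrapT => ne; apply: e.
  have stw : (sigma w < tau w)%E by rewrite lt_neqAle st andbT; apply/eqP.
  have [r [r0 rt sr rtau]] : exists r : rat, [/\ 0 <= ratr r :> R,
      ratr r <= t, (sigma w <= (ratr r)%:E)%E & ((ratr r)%:E < tau w)%E].
    have := s0 w; case: (sigma w) (tau w) tw stw => [x| |] [y| |] //.
    rewrite !lte_fin !lee_fin => yt xy x0.
    have [r] := rat_in_itvoo xy; rewrite in_itv /= => /andP[xr ry].
    by exists r; rewrite !lee_fin lte_fin; split; lra.
  exists (pickle r) => //=; rewrite /q pickleK /= (max_idPr r0) (min_idPr rt).
  by split=> //; apply/negP; rewrite -ltNge.
split.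
  apply: measurableI => //.
  rewrite (_ : [set w | _] = (\bigcup_n
       ([set w | (tau w <= n%:R%:E)%E] `&` [set w | sigma w = tau w]))
     `|` (~` \bigcup_n [set w | (sigma w <= n%:R%:E)%E])).
    apply: measurableU.
      apply: bigcup_measurable => n _.
      exact/(filtration_measurable hF (ler0n R n))/eqF.
    apply/measurableC/bigcup_measurable => n _.
    exact/(filtration_measurable hF (ler0n R n))/sF.
  have bnd (x : R) : exists n, x <= n%:R.
    by exists (Num.trunc x).+1; rewrite ltW// truncnS_gt.
  apply/seteqP; split=> w /=.
    move=> e; have [[n tn]|nt] :=
      pselect (exists n, (tau w <= n%:R%:E)%E); first by left; exists n.
    by right=> -[n _ /=]; rewrite e => tn; apply: nt; exists n.
  case=> [[n _ /= []//]|nsy].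
  suff sy : sigma w = +oo%E by have := st w; rewrite sy leye_eq => /eqP.
  case sE : (sigma w) (s0 w) => [x| |] // _; case: nsy.
  by have [n xn] := bnd x; exists n => //=; rewrite sE lee_fin.
move=> t t0'; rewrite (_ : _ `&` _ `&` _ = (A `&` [set w | (tau w <= t%:E)%E]) `&`
  ([set w | (tau w <= t%:E)%E] `&` [set w | sigma w = tau w])).
  by apply: (sigma_algebra_setI (FS t0')); [exact: FA|exact: eqF].
apply/seteqP; split=> w /= [[Aw]].
  by move=> e; rewrite e.
by move=> ? [? e]; rewrite e.
Qed.

(** For s > t, an outcome with sigma <= t has sigma_n <= s for some n, so the
    event is known at every time s > t, hence at time t by right
    continuity. *)
Lemma stopped_right_continuous sigma (sigma_ : nat -> Omega -> \bar R) A :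
  stopping_time F sigma ->
  (forall w s t, s < t -> (sigma w <= s%:E)%E ->
     exists n, (sigma_ n w <= t%:E)%E) ->
  (forall n, stopped_sigma_algebra F (sigma_ n) A) ->
  stopped_sigma_algebra F sigma A.
Proof.
move=> [s0 sF] cv As; split=> [|t t0]; first by case: (As 0%N).
rewrite (filtration_right_continuous hF t0) => s /= ts.
have ss : 0 <= s by lra.
rewrite (_ : _ `&` _ = [set w | (sigma w <= t%:E)%E] `&`
  \bigcup_n (A `&` [set w | (sigma_ n w <= s%:E)%E])).
  apply: (sigma_algebra_setI (FS ss)).
    by apply: (filtration_nondecreasing hF t0 (ltW ts)); exact: sF.
  by apply: (sigma_algebra_bigcup (FS ss)) => n; case: (As n) => _; exact.
apply/seteqP; split=> w /=.
  by move=> [Aw sw]; split=> //; have [n nw] := cv w t s ts sw; exists n.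
by move=> [sw [n _ []]].
Qed.

Lemma stopping_time_lt sigma t : stopping_time F sigma -> 0 <= t ->
  F t [set w | (sigma w < t%:E)%E].
Proof.
move=> [s0 sF] t0.
pose r n : R := ratr (odflt 0 (unpickle n : option rat)).
rewrite (_ : [set _ | _] = \bigcup_n
    (if 0 <= r n < t then [set w | (sigma w <= (r n)%:E)%E] else set0)).
  apply: (sigma_algebra_bigcup (FS t0)) => n.
  case: ifP => [/andP[r0 rt]|_]; last by case: (FS t0).
  by apply: (filtration_nondecreasing hF r0 (ltW rt)); exact: sF.
apply/seteqP; split=> w /=; last first.
  move=> [n _]; case: ifP => //= /andP[_ rt] /le_lt_trans; apply.
  by rewrite lte_fin.
move=> st; have [q [q0 qt sq]] : exists q : rat, [/\ 0 <= ratr q :> R,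
    ratr q < t & (sigma w <= (ratr q)%:E)%E].
  have := s0 w; case: (sigma w) st => [x| |] //; rewrite lte_fin lee_fin => xt x0.
  have [q] := rat_in_itvoo xt; rewrite in_itv /= => /andP[xq qt].
  by exists q; rewrite lee_fin; split; lra.
by exists (pickle q) => //; rewrite /r pickleK /= q0 qt.
Qed.

End stopping_times.

(** * Dyadic times *)

Section dyadic.
Context (R : realType).
Implicit Types (r t : R) (n k : nat).

Definition dyadic : set R := [set r | exists k n, r = k%:R / 2 ^+ n].

(** The least multiple of 2^-n strictly above r.  Strictness matters: the
    discretized time approaches r from the right, where the regularized path
    takes its limits. *)
Definition dyadic_above n r : R := (Num.trunc (r * 2 ^+ n)).+1%:R / 2 ^+ n.

Let pow2_gt0 n : 0 < 2 ^+ n :> R. Proof. exact: exprn_gt0. Qed.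

Lemma dyadic_above_dyadic n r : dyadic (dyadic_above n r).
Proof. by exists (Num.trunc (r * 2 ^+ n)).+1, n. Qed.

Lemma dyadic_above_gt n r : r < dyadic_above n r.
Proof. by rewrite ltr_pdivlMr// truncnS_gt. Qed.

Lemma dyadic_above_le n r : 0 <= r -> dyadic_above n r <= r + 2 ^- n.
Proof.
move=> r0; rewrite ler_pdivrMr// mulrDl mulVf ?gt_eqF// -natr1 lerD2r.
by have /andP[] := truncn_itv (mulr_ge0 r0 (ltW (pow2_gt0 n))).
Qed.

Lemma dyadic_aboveS n r : 0 <= r -> dyadic_above n.+1 r <= dyadic_above n r.
Proof.
move=> r0; rewrite /dyadic_above exprS ler_pdivrMr ?mulr_gt0//.
rewrite [leRHS]mulrCA divfK ?gt_eqF// -natrM ler_nat.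
have := dyadic_above_gt n r; rewrite ltr_pdivlMr// => h.
have r2 : 0 <= r * (2 * 2 ^+ n) by rewrite mulr_ge0// ltW// mulr_gt0.
by rewrite truncn_lt_nat// natrM mulrCA ltr_pM2l.
Qed.

Lemma dyadic_above_cvg r : 0 <= r ->
  dyadic_above n r @[n --> \oo] --> r.
Proof.
move=> r0; apply: (@squeeze_cvgr _ _ _ _ (cst r) (fun n => r + 2 ^- n)).
- apply: nearW => n; rewrite /= dyadic_above_le// andbT ltW//.
  exact: dyadic_above_gt.
- exact: cvg_cst.
- rewrite -[X in _ --> X]addr0; apply: cvgD; first exact: cvg_cst.
  under eq_cvg do rewrite -exprVn.
  by apply: cvg_expr; rewrite ger0_norm; lra.
Qed.

Lemma dyadic_dense (u v : R) : 0 <= u -> u < v ->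
  exists2 s, dyadic s & u < s < v.
Proof.
move=> u0 uv.
have /cvgr_lt /(_ v uv) [n _ /(_ n (leqnn n)) /= nv] := dyadic_above_cvg u0.
exists (dyadic_above n u); first exact: dyadic_above_dyadic.
by rewrite dyadic_above_gt.
Qed.

Lemma dyadic_ge0 r : dyadic r -> 0 <= r.
Proof. by move=> [k [n ->]]; rewrite divr_ge0// ltW. Qed.

Lemma dyadic_above_ge0 n r : 0 <= dyadic_above n r.
Proof. exact/dyadic_ge0/dyadic_above_dyadic. Qed.

(** The time at infinity is kept at infinity, where the price is the claim
    itself. *)
Definition edyadic_above n (x : \bar R) : \bar R :=
  if x is r%:E then (dyadic_above n r)%:E else +oo%E.

(** Deciding whether the discretized time has passed t only requires to know
    whether the original time lies strictly before a multiple of 2^-n that is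
    at most t; this is why the discretization is a stopping time. *)
Lemma dyadic_above_leE n r t : 0 <= r -> 0 <= t ->
  (dyadic_above n r <= t) = (r < (Num.trunc (t * 2 ^+ n))%:R / 2 ^+ n).
Proof.
move=> r0 t0; rewrite ler_pdivrMr// ltr_pdivlMr//.
rewrite -truncn_lt_nat; last by rewrite mulr_ge0// ltW.
by rewrite truncn_ge_nat// mulr_ge0// ltW.
Qed.

Lemma stopping_time_dyadic d (Omega : measurableType d)
    (P : probability Omega R) (F : R -> set (set Omega))
    (hF : usual_filtration P F) (sigma : Omega -> \bar R) n :
  stopping_time F sigma -> stopping_time F (edyadic_above n \o sigma).
Proof.
move=> st; split=> [w|t t0] /=.
  case: st => + _ => /(_ w); case: (sigma w) => [r| |]//= _.
  by rewrite lee_fin dyadic_above_ge0.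
pose u : R := (Num.trunc (t * 2 ^+ n))%:R / 2 ^+ n.
have u0 : 0 <= u by rewrite divr_ge0// ltW.
have ut : u <= t.
  rewrite ler_pdivrMr//.
  by have /andP[] := truncn_itv (mulr_ge0 t0 (ltW (pow2_gt0 n))).
rewrite (_ : [set _ | _] = [set w | (sigma w < u%:E)%E]).
  apply: (filtration_nondecreasing hF u0 ut).
  exact: (stopping_time_lt hF).
apply/seteqP; split=> w /=; case: st => + _ => /(_ w);
  case: (sigma w) => [r| |]//=; rewrite !lee_fin lte_fin => r0;
  by rewrite dyadic_above_leE.
Qed.

End dyadic.

(** * Doob's upcrossing inequality *)

Section upcrossing_inequality.
Context d (Omega : measurableType d) (R : realType) (Q : probability Omega R).
Context (F : R -> set (set Omega)).
Hypothesis FS : forall t, 0 <= t -> sigma_algebra setT (F t).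
Hypothesis Fm : forall t, 0 <= t -> F t `<=` measurable.
Hypothesis Fle : forall s t, 0 <= s -> s <= t -> F s `<=` F t.
Context (p : R -> Omega -> R).
Hypothesis p0 : forall t w, 0 <= p t w.
Hypothesis pF : forall t, 0 <= t -> measurable_wrt (F t) (p t).
Hypothesis psuper : forall s t A, 0 <= s -> s <= t -> F s A ->
  (\int[Q]_(w in A) (p t w)%:E <= \int[Q]_(w in A) (p s w)%:E)%E.

Let pm t : 0 <= t -> measurable_fun setT (p t).
Proof.
by move=> t0; exact: measurable_wrt_measurable (FS t0) (@Fm t t0) _ _ _ (pF t0).
Qed.

Lemma measurable_upcross (a b : R) h s : all (fun t => 0 <= t) s ->
  measurable_fun setT
    (fun w => (upcross a b h [seq p t w | t <- s])%:R : R).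
Proof.
elim: s h => [|t s IH] h /=; first by move=> _; exact: measurable_cst.
move=> /andP[t0 s0]; case: h.
  rewrite (_ : (fun _ => _) = (fun w => if b <= p t w
      then 1 + (upcross a b false [seq p t w | t <- s])%:R
      else (upcross a b true [seq p t w | t <- s])%:R)); last first.
    by apply/funext => w; case: ifP; rewrite // -natr1 addrC.
  apply: measurable_fun_ifT; last exact: IH.
    by apply: measurable_fun_ler; [exact: measurable_cst|exact: pm].
  by apply: measurable_funD; [exact: measurable_cst|exact: IH].
rewrite (_ : (fun _ => _) = (fun w => if p t w <= a
    then (upcross a b true [seq p t w | t <- s])%:R
    else (upcross a b false [seq p t w | t <- s])%:R)); last first.
  by apply/funext => w; case: ifP.
apply: measurable_fun_ifT; [|exact: IH..].
by apply: measurable_fun_ler; [exact: pm|exact: measurable_cst].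
Qed.

Lemma ge0_integral_setID (f : Omega -> \bar R) (A B : set Omega) :
  measurable A -> measurable B -> measurable_fun setT f ->
  (forall w, (0 <= f w)%E) ->
  (\int[Q]_(w in A) f w =
   \int[Q]_(w in A `&` B) f w + \int[Q]_(w in A `\` B) f w)%E.
Proof.
move=> mA mB mf f0; rewrite -ge0_integral_setU ?setUIDK//.
- exact: measurableI.
- exact: measurableD.
- exact: measurable_funTS.
- by apply/disj_set2P; rewrite setDE setIACA setICr setI0.
Qed.

(** Doob's inequality by induction on the grid, for a nonnegative
    supermartingale p.  The trader who holds nothing expects at most a, the one
    who holds the asset at time t at most p_t: on {p_u <= a} a purchase at the
    next time u leaves the bound p_u <= a, while on {b <= p_u} a sale earns
    b - a and leaves the bound a, in total b <= p_u.  The supermartingale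
    property passes from p_u to p_t.  Both bounds are needed at once, and
    localized to every event A known at time t, for the induction to go
    through. *)
Lemma upcrossing_integral (a b : R) s t A : 0 <= a -> a < b -> 0 <= t ->
  path <=%R t s -> F t A ->
  (\int[Q]_(w in A) ((b - a) * (upcross a b false [seq p u w | u <- s])%:R)%:E
     <= \int[Q]_(w in A) a%:E)%E /\
  (\int[Q]_(w in A) ((b - a) * (upcross a b true [seq p u w | u <- s])%:R)%:E
     <= \int[Q]_(w in A) (p t w)%:E)%E.
Proof.
move=> a0 ab; elim: s t A => [|u s IH] t A t0 /= ts FA.
  have mA := Fm t0 FA; rewrite mulr0.
  rewrite integral0; split; apply: integral_ge0 => w _; rewrite lee_fin//.
move: ts => /andP[tu us]; have u0 : 0 <= u := le_trans t0 tu.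
have mA := Fm t0 FA; have FuA := Fle t0 tu FA.
have s0 : all (fun t => 0 <= t) (u :: s).
  apply/allP => r; rewrite inE => /predU1P[->//|rs].
  by apply: (le_trans u0); move/(order_path_min le_trans)/allP: us; exact.
have mf h s' : all (fun t => 0 <= t) s' -> measurable_fun setT (fun w =>
    ((b - a) * (upcross a b h [seq p u w | u <- s'])%:R)%:E).
  move=> s'0; apply/measurable_EFinP/measurable_funM => //.
  exact: measurable_upcross.
have f0 h s' w :
    (0 <= ((b - a) * (upcross a b h [seq p u w | u <- s'])%:R)%:E)%E.
  by rewrite lee_fin mulr_ge0// subr_ge0 ltW.
have FpB B : measurable B -> F u (p u @^-1` B).
  by move=> mB; have /(measurable_wrtP (FS u0)) := pF u0; exact.
have mpu : measurable_fun setT (fun w => (p u w)%:E).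
  by apply/measurable_EFinP; exact: pm.
have pu0 w : (0 <= (p u w)%:E)%E by rewrite lee_fin.
split.
  pose B : set Omega := p u @^-1` `]-oo, a].
  have FB : F u B by apply: FpB.
  have mB := Fm u0 FB.
  rewrite (ge0_integral_setID mA mB (mf false (u :: s) s0) (f0 false (u :: s))).
  rewrite [leRHS](ge0_integral_setID mA mB)//.
  apply: leeD.
    rewrite (eq_integral (fun w =>
      ((b - a) * (upcross a b true [seq p u w | u <- s])%:R)%:E)); last first.
      by move=> w /set_mem[_]; rewrite /B /= in_itv /= => ->.
    have [_ /le_trans] := IH u (A `&` B) u0 us (sigma_algebra_setI (FS u0) FuA FB).
    apply; apply: ge0_le_integral => //; first exact: measurableI.
    - exact: measurable_funTS.
    - by move=> w [_]; rewrite /B /= in_itv.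
  rewrite (eq_integral (fun w =>
    ((b - a) * (upcross a b false [seq p u w | u <- s])%:R)%:E)); last first.
    by move=> w /set_mem[_]; rewrite /B /= in_itv /= => /negP/negbTE ->.
  by have [] := IH u (A `\` B) u0 us (sigma_algebra_setD (FS u0) FuA FB).
pose B : set Omega := p u @^-1` `[b, +oo[.
have FB : F u B by apply: FpB.
have mB := Fm u0 FB.
apply: le_trans (psuper t0 tu FA).
rewrite (ge0_integral_setID mA mB (mf true (u :: s) s0) (f0 true (u :: s))).
rewrite [leRHS](ge0_integral_setID mA mB)//.
apply: leeD.
  rewrite (eq_integral (fun w => (b - a)%:E +
    ((b - a) * (upcross a b false [seq p u w | u <- s])%:R)%:E)%E); last first.
    move=> w /set_mem[_]; rewrite /B /= in_itv /= andbT => ->.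
    by rewrite -natr1 mulrDr mulr1 EFinD addeC.
  have mAB := measurableI _ _ mA mB.
  have ba0 : (0 <= (b - a)%:E)%E by rewrite lee_fin subr_ge0 ltW.
  have s0' : all (fun t => 0 <= t) s by case/andP: s0.
  have mf' := measurable_funS measurableT (@subsetT _ (A `&` B))
    (mf false s s0').
  rewrite (ge0_integralD _ _ (fun _ _ => ba0) _ (fun w _ => f0 false s w))//.
  have [+ _] := IH u (A `&` B) u0 us (sigma_algebra_setI (FS u0) FuA FB).
  move=> /(leeD2l (\int[Q]_(_ in A `&` B) (b - a)%:E)%E)/le_trans; apply.
  rewrite -ge0_integralD//.
  apply: ge0_le_integral => //.
  - by move=> w _; rewrite -EFinD lee_fin; lra.
  - exact: measurable_funTS.
  - by move=> w [_]; rewrite /B /= in_itv /= andbT -EFinD lee_fin; lra.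
rewrite (eq_integral (fun w =>
  ((b - a) * (upcross a b true [seq p u w | u <- s])%:R)%:E)); last first.
  by move=> w /set_mem[_]; rewrite /B /= in_itv /= andbT => /negP/negbTE ->.
by have [] := IH u (A `\` B) u0 us (sigma_algebra_setD (FS u0) FuA FB).
Qed.

Context (e : nat -> R).
Hypothesis e0 : forall n, 0 <= e n.

Let grid n := sort <=%R (undup [seq e i | i <- iota 0 n]).

Let grid0 n : all (fun t => 0 <= t) (grid n).
Proof.
by apply/allP => t; rewrite mem_sort mem_undup => /mapP[i _ ->].
Qed.

Let lt_grid n : sorted <%R (grid n).
Proof.
by rewrite lt_sorted_uniq_le sort_uniq undup_uniq sort_le_sorted.
Qed.

Let grid_subseq s n : sorted <%R s -> {subset s <= [seq e i | i <- iota 0 n]} ->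
  subseq s (grid n).
Proof.
move=> ss sub; rewrite (_ : s = [seq x <- grid n | x \in s]) ?filter_subseq//.
apply: lt_sorted_eq => //; first exact/(subseq_lt_sorted (filter_subseq _ _))/lt_grid.
move=> t; rewrite mem_filter mem_sort mem_undup /=.
by case: (boolP (t \in s)) => //= /sub.
Qed.

(** The upcrossings of the first n times increase with n and have bounded
    expectation, so their limit is almost surely finite; any finite set of
    times is contained in one of these grids. *)
Lemma ae_bounded_upcross_level (a b : R) : 0 <= a -> a < b ->
  \forall w \ae Q, exists K : nat, forall s, sorted <%R s ->
    {in s, forall t, range e t} ->
    (upcross a b false [seq p t w | t <- s] <= K)%N.
Proof.
move=> a0 ab.
pose U n w : \bar R := ((b - a) * (upcross a b false [seq p t w | t <- grid n])%:R)%:E.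
have mU n : measurable_fun setT (U n).
  apply/measurable_EFinP/measurable_funM => //.
  exact: measurable_upcross.
have U0 n w : (0 <= U n w)%E by rewrite lee_fin mulr_ge0// subr_ge0 ltW.
have ndU w : {homo U^~ w : n m / (n <= m)%N >-> (n <= m)%E}.
  move=> n m nm; rewrite lee_fin ler_wpM2l//; first by rewrite subr_ge0 ltW.
  rewrite ler_nat.
  apply/subseq_upcross/map_subseq/grid_subseq; first exact: lt_grid.
  move=> t; rewrite mem_sort mem_undup => /mapP[i]; rewrite mem_iota => /andP[_].
  rewrite add0n => im ->; apply: map_f; rewrite mem_iota /= add0n.
  exact: leq_trans im nm.
have IU n : (\int[Q]_w U n w <= a%:E)%E.
  have pt : path <=%R 0 (grid n).
    rewrite path_min_sorted; last exact: grid0.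
    by have := lt_grid n; rewrite lt_sorted_uniq_le => /andP[].
  have [+ _] := upcrossing_integral a0 ab (lexx 0) pt
    (sigma_algebra_setT (FS (lexx 0))).
  move=> /le_trans; apply; rewrite integral_cst//.
  by rewrite [X in (_ * X)%E](_ : _ = 1%E) ?mule1//; exact: probability_setT.
have IL : (\int[Q]_w limn (U^~ w) <= a%:E)%E.
  rewrite (monotone_convergence Q measurableT mU)//.
  apply: lime_le; last exact: nearW.
  apply: ereal_nondecreasing_is_cvgn => n m nm.
  by apply: ge0_le_integral => // w _; exact: ndU.
have L0 w : (0 <= limn (U^~ w))%E.
  by apply: lime_ge; [exact: ereal_nondecreasing_is_cvgn|exact: nearW].
have intL : Q.-integrable setT (fun w => limn (U^~ w)).
  apply/integrableP; split.
    apply: (@emeasurable_fun_cvg _ _ _ _ U) => // w _.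
    exact: ereal_nondecreasing_is_cvgn.
  under eq_integral do rewrite gee0_abs//.
  exact: le_lt_trans IL (ltry _).
apply: filterS (integrable_ae measurableT intL) => w /(_ I) /fineK Lfin.
have [K LK] : exists K : nat, fine (limn (U^~ w)) / (b - a) <= K%:R.
  by exists (Num.trunc (fine (limn (U^~ w)) / (b - a))).+1; rewrite ltW// truncnS_gt.
exists K => s ss se.
have [n sn] : exists n, {subset s <= [seq e i | i <- iota 0 n]}.
  elim: (s) se => [|t s' IH] s'e; first by exists 0%N.
  have [r rs'|n sn] := IH; first by apply: s'e; rewrite inE rs' orbT.
  have [i _ it] := s'e t (mem_head _ _); exists (maxn n i.+1) => r.
  rewrite inE => /predU1P[->|/sn/mapP[j]].
    by rewrite -it map_f// mem_iota add0n leq_max ltnSn orbT.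
  rewrite mem_iota add0n => /andP[_ jn] ->; rewrite map_f// mem_iota add0n.
  by rewrite leq_max jn.
apply: (leq_trans (subseq_upcross _ _ _ (map_subseq _ (grid_subseq ss sn)))).
rewrite -(ler_nat R); apply: le_trans LK.
rewrite ler_pdivlMr ?subr_gt0// mulrC -lee_fin Lfin.
apply: lime_ge; first exact: ereal_nondecreasing_is_cvgn.
by exists n => // k /= nk; exact: (ndU w).
Qed.

Lemma ae_bounded_upcross :
  \forall w \ae Q, bounded_upcross (range e) (p^~ w).
Proof.
pose B (ab : rat * rat) w := 0 <= ratr ab.1 :> R -> ab.1 < ab.2 ->
  exists K : nat, forall s, sorted <%R s -> {in s, forall t, range e t} ->
    (upcross (ratr ab.1) (ratr ab.2) false [seq p t w | t <- s] <= K)%N.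
have : \forall w \ae Q, forall n, if (unpickle n : option (rat * rat)) is Some ab
    then B ab w else True.
  apply: ae_foralln => n; case: unpickle => [[a b]|]; last exact: nearW.
  rewrite /B /=; have [a0|a0] := boolP (0 <= ratr a :> R); last exact: nearW.
  have [ab|ab] := boolP (a < b); last exact: nearW.
  have abR : ratr a < ratr b :> R by rewrite ltr_rat.
  by apply: filterS (ae_bounded_upcross_level a0 abR) => w h _ _.
apply: filterS => w Bw a b ab; have [a0|a0] := leP 0 (ratr a : R).
  by have := Bw (pickle (a, b)); rewrite pickleK; apply.
exists 0%N => s _ _; elim: s => //= t s IH.
by rewrite leNgt (lt_le_trans a0 (p0 t w)).
Qed.

End upcrossing_inequality.

(** * Conditional expectations *)

Lemma integrable_ae_bounded d (Omega : measurableType d) (R : realType)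
    (Q : probability Omega R) (f : Omega -> R) (c : R) :
  measurable_fun setT f -> (\forall w \ae Q, `|f w| <= c) ->
  Q.-integrable setT (EFin \o f).
Proof.
move=> mf fc; apply/integrableP; split; first exact/measurable_EFinP.
apply: (@le_lt_trans _ _ (\int[Q]_(w in setT) (Num.max c 0)%:E)%E); last first.
  rewrite integral_cst// [X in (_ * X)%E](_ : _ = 1%E).
    by rewrite mule1 ltry.
  exact: probability_setT.
apply: ae_ge0_le_integral => //.
- by apply/measurableT_comp => //; exact/measurable_EFinP.
- by move=> w _; rewrite lee_fin le_max lexx orbT.
- by apply: filterS fc => w fc _; rewrite lee_fin le_max fc.
Qed.

Section conditional_expectation.
Context d (Omega : measurableType d) (R : realType) (Q : probability Omega R).
Context (G : set (set Omega)).
Hypotheses (hG : sigma_algebra setT G) (Gm : G `<=` measurable).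

(** The conditional expectation is the Radon-Nikodym derivative of
    A |-> int_A X dQ with respect to Q, both restricted to G, i.e. viewed on
    the measurable space generated by G. *)
Lemma cond_exp_exists (X : Omega -> R) : Q.-integrable setT (EFin \o X) ->
  exists Y, is_cond_exp Q G X Y.
Proof.
move=> iX.
pose T' := g_sigma_algebraType G.
have GE : @measurable _ T' = G := measurable_g_measurableTypeE hG.
pose i : Omega -> T' := fun w => w.
have mi : measurable_fun setT i by move=> _ B; rewrite GE setTI; exact: Gm.
pose i' : {mfun Omega >-> T'} := HB.pack i (isMeasurableFun.Build _ _ _ _ i mi).
pose mu : probability T' R := distribution Q i'.
pose ind : {charge set Omega -> \bar R} := induced_charge iX.
pose nu0 : set T' -> \bar R := ind.
have nu0_fin A : measurable A -> nu0 A \is a fin_num.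
  by rewrite GE => /Gm; exact: fin_num_measure.
have nu0_add : semi_sigma_additive nu0.
  move=> A mA tA mUA; apply: (@charge_semi_sigma_additive _ _ _ ind) => //.
    by move=> n; apply: Gm; rewrite -GE; exact: mA.
  by apply: Gm; rewrite -GE; exact: mUA.
pose nu : {charge set T' -> \bar R} :=
  HB.pack nu0 (isCharge.Build _ _ _ nu0 (charge0 ind) nu0_fin nu0_add).
have numu : nu `<< mu.
  apply/null_content_dominatesP => A mA A0.
  rewrite /nu /= /nu0 /= /induced_charge null_set_integral//.
  - by apply: Gm; rewrite -GE.
  - by apply: measurable_funTS; exact: measurable_int iX.
pose f := Radon_Nikodym nu mu.
have intf : mu.-integrable setT f := Radon_Nikodym_integrable numu.
have mf : measurable_fun setT f := measurable_int _ intf.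
have fE w : f w = (fine (f w))%:E by rewrite fineK// Radon_Nikodym_fin_num.
have intfQ : Q.-integrable setT (f \o i).
  apply/integrableP; split; first exact: (measurableT_comp mf mi).
  case/integrableP : intf => _; rewrite ge0_integral_pushforward//.
  exact: measurableT_comp.
exists (fun w => fine (f w)); split.
- exact: (measurableT_comp (@fine_measurable R setT measurableT) mf).
- by rewrite (_ : EFin \o _ = f \o i)//; apply/funext => w /=; rewrite -fE.
- move=> A GA; have mA : @measurable _ T' A by rewrite GE.
  have := Radon_Nikodym_integral numu mA; rewrite -/f => nuE.
  transitivity (\int[mu]_(w in A) f w)%E; last by rewrite -nuE.
  rewrite (integral_pushforward mi mf)//.
    by apply: eq_integral => w _; rewrite /= -fE.
  by apply: integrableS intfQ => //; exact: Gm.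
Qed.

Lemma cond_expP (X : Omega -> R) : Q.-integrable setT (EFin \o X) ->
  is_cond_exp Q G X (cond_exp Q G X).
Proof.
by move=> /cond_exp_exists[Y XY]; rewrite /cond_exp; case: xgetP => // /(_ Y).
Qed.

(** Apply the hypothesis to the event {g < f}. *)
Lemma ae_le_integral_events (f g : Omega -> R) :
  measurable_wrt G f -> measurable_wrt G g ->
  Q.-integrable setT (EFin \o f) -> Q.-integrable setT (EFin \o g) ->
  (forall A, G A ->
    (\int[Q]_(w in A) (f w)%:E <= \int[Q]_(w in A) (g w)%:E)%E) ->
  \forall w \ae Q, f w <= g w.
Proof.
move=> mf mg intf intg fg.
pose A := [set w | g w < f w].
have GA : G A.
  have := @measurable_fun_ltr _ (g_sigma_algebraType G) _ setT g f mg mf.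
  move=> /(_ measurableT [set true] I); rewrite setTI.
  by rewrite (measurable_g_measurableTypeE hG).
have mA := Gm GA.
have intfA := integrableS measurableT mA (@subsetT _ A) intf.
have intgA := integrableS measurableT mA (@subsetT _ A) intg.
have IA : (\int[Q]_(w in A) `|(f w)%:E - (g w)%:E| = 0)%E.
  apply/eqP; rewrite eq_le integral_ge0// andbT.
  rewrite (eq_integral (fun w => (f w)%:E - (g w)%:E)%E); last first.
    by move=> w /set_mem gf; rewrite gee0_abs// sube_ge0// lee_fin ltW.
  rewrite integralB_EFin// sube_le0; exact: fg.
have : ae_eq Q A (fun w => (f w)%:E - (g w)%:E)%E (cst 0%E).
  apply/(ae_eq_integral_abs Q mA) => //.
  exact: (measurable_int Q (integrableB mA intfA intgA)).
apply: filterS => w h; rewrite leNgt; apply/negP => gf.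
by have := h gf; rewrite /= -EFinB => -[] ?; move: gf; lra.
Qed.

End conditional_expectation.

(** * Bounded random variables *)

Section bounded_random_variables.
Context d (Omega : measurableType d) (R : realType) (P : probability Omega R).

Lemma Linfty_bounded (X : Linfty P) :
  exists2 c, 0 <= c & \forall w \ae P, `|X w| <= c.
Proof.
have : ('N[P]_+oo [EFin \o X] < +oo)%E by exact: Lfunction_finite.
rewrite unlock /Lnorm ifT; last first.
  rewrite [X in (_ < X)%E](_ : _ = 1%E) ?lte01//; exact: probability_setT.
set e := ess_sup _ _ => efin.
have eX : \forall w \ae P, (`|(X w)%:E| <= e)%E by exact: ess_sup_ge.
exists (Num.max 0 (fine e)); first by rewrite le_max lexx.
apply: filterS eX => w; case: e efin => [e| |]//= _.
by rewrite lee_fin le_max => ->; rewrite orbT.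
Qed.

Lemma Linfty_intro (f : Omega -> R) (c : R) : measurable_fun setT f ->
  (\forall w \ae P, `|f w| <= c) -> exists X : Linfty P, f = X.
Proof.
move=> mf fc; have fL : f \in Lfun P +oo%E.
  rewrite inE; apply/andP; split; rewrite inE//=.
  rewrite /finite_norm unlock /Lnorm; case: ifP => // _.
  apply: (@le_lt_trans _ _ c%:E); last exact: ltry.
  apply/ess_supP; exact: fc.
by exists (Lfun_Sub (leey 1%E) fL).
Qed.

Lemma Linfty_bounded2 (X Y : Linfty P) : exists2 c, 0 <= c &
  (\forall w \ae P, `|X w| <= c) /\ (\forall w \ae P, `|Y w| <= c).
Proof.
have [a a0 Xa] := Linfty_bounded X; have [b b0 Yb] := Linfty_bounded Y.
exists (a + b); first exact: addr_ge0.
by split; [apply: filterS Xa|apply: filterS Yb] => w h; lra.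
Qed.

Lemma null_dominates_ae (Q : probability Omega R) (A : set Omega) :
  Q `<< P -> (\forall w \ae P, A w) -> \forall w \ae Q, A w.
Proof.
move=> QP [N [mN N0 AN]]; exists N; split=> //.
by apply/(measure0_null_setP _ mN)/QP/(measure0_null_setP _ mN).
Qed.

Lemma Linfty_integrable (Q : probability Omega R) (X : Linfty P) :
  Q `<< P -> Q.-integrable setT (EFin \o X).
Proof.
move=> QP; have [c _ Xc] := Linfty_bounded X.
apply: (@integrable_ae_bounded _ _ _ Q X c) => //.
exact: null_dominates_ae Xc.
Qed.

End bounded_random_variables.

(** * Pricing procedures *)

Section pricing.
Context d (Omega : measurableType d) (R : realType) (P : probability Omega R).
Context (F : R -> set (set Omega)) (hF : usual_filtration P F).
Context (Pi : (Omega -> \bar R) -> (Omega -> \bar R) -> Linfty P -> Linfty P).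
Hypothesis hPi : TCPP F Pi.
Implicit Types (sigma tau : Omega -> \bar R) (X Y Z : Linfty P).

Let dpp := TCPP_dpp hPi.
Let SS sigma (s : stopping_time F sigma) := stopped_sigma_algebraP hF s.

Lemma Linfty_at_sub sigma tau X : stopping_pair F sigma tau ->
  Linfty_at F sigma X -> Linfty_at F tau X.
Proof.
move=> st; have [ss tt _] := st.
exact: (measurable_wrt_sub (SS ss) (SS tt) (stopped_nondecreasing hF st)).
Qed.

Lemma Linfty_at_timeoo X : Linfty_at F timeoo X.
Proof.
have sto : stopping_time F timeoo by apply: (stopping_time_cst hF).
apply/(measurable_wrtP (SS sto)) => B mB.
rewrite (stopped_timeoo hF) -[X in measurable X]setTI.
exact: measurable_funP.
Qed.

Lemma Linfty_at_cst sigma (c : R) : stopping_time F sigma ->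
  exists2 Z : Linfty P, Linfty_at F sigma Z & forall w, Z w = c.
Proof.
move=> ss.
have [||Z ZE] := @Linfty_intro _ _ _ P (cst c) `|c|.
- exact: measurable_cst.
- exact: nearW.
exists Z; last by move=> w; rewrite -ZE.
by rewrite /Linfty_at /= /measurable_wrt -ZE; exact: measurable_cst.
Qed.

Lemma Linfty_at_indic sigma (c : R) A : stopping_time F sigma ->
  stopped_sigma_algebra F sigma A ->
  exists2 Z : Linfty P, Linfty_at F sigma Z & forall w, Z w = c * \1_A w.
Proof.
move=> ss FA; have [mA _] := FA.
have mf : measurable_wrt (stopped_sigma_algebra F sigma)
    (fun w => c * \1_A w : R).
  apply: (measurable_wrt_patch (SS ss) FA (g := cst c)).
  - exact: measurable_cst.
    by move=> w wA; rewrite indicE wA mulr1.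
  by move=> w nA; rewrite indicE memNset// mulr0.
have [|Z ZE] := @Linfty_intro _ _ _ P (fun w => c * \1_A w) `|c|
  (measurable_wrt_measurable (SS ss) (@stopped_measurable _ _ _ F sigma) mf).
  apply: nearW => w; rewrite normrM -[leRHS]mulr1 ler_wpM2l//.
  by rewrite indicE; case: (_ \in _); rewrite ?normr0 ?normr1.
exists Z; last by move=> w; rewrite -ZE.
by rewrite /Linfty_at /= -ZE.
Qed.

Lemma price_known sigma tau Z : stopping_pair F sigma tau ->
  Linfty_at F sigma Z -> \forall w \ae P, Pi sigma tau Z w = Z w.
Proof.
move=> st LZ; have [ss tt _] := st.
have L0 : Linfty_at F tau (0 : Linfty P).
  by rewrite /Linfty_at /= /measurable_wrt; exact: measurable_cst.
have := dpp_translation dpp st L0 LZ; have := dpp_normalized dpp st.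
by rewrite add0r; apply: filterS2 => w -> ->; rewrite add0r.
Qed.

Lemma price_le_known sigma tau X Z : stopping_pair F sigma tau ->
  Linfty_at F tau X -> Linfty_at F sigma Z ->
  (\forall w \ae P, X w <= Z w) -> \forall w \ae P, Pi sigma tau X w <= Z w.
Proof.
move=> st LX LZ XZ; have LZ' := Linfty_at_sub st LZ.
have := dpp_monotone dpp st LX LZ' XZ; have := price_known st LZ.
by apply: filterS2 => w ->.
Qed.

Lemma price_ge_known sigma tau X Z : stopping_pair F sigma tau ->
  Linfty_at F tau X -> Linfty_at F sigma Z ->
  (\forall w \ae P, Z w <= X w) -> \forall w \ae P, Z w <= Pi sigma tau X w.
Proof.
move=> st LX LZ XZ; have LZ' := Linfty_at_sub st LZ.
have := dpp_monotone dpp st LZ' LX XZ; have := price_known st LZ.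
by apply: filterS2 => w ->.
Qed.

Lemma price_ae_eq sigma tau X Y : stopping_pair F sigma tau ->
  Linfty_at F tau X -> Linfty_at F tau Y -> (\forall w \ae P, X w = Y w) ->
  \forall w \ae P, Pi sigma tau X w = Pi sigma tau Y w.
Proof.
move=> st LX LY XY.
have XleY : \forall w \ae P, X w <= Y w by apply: filterS XY => w ->.
have YleX : \forall w \ae P, Y w <= X w by apply: filterS XY => w ->.
have h1 := dpp_monotone dpp st LX LY XleY.
have h2 := dpp_monotone dpp st LY LX YleX.
by apply: filterS2 h1 h2 => w ? ?; apply/eqP; rewrite eq_le; apply/andP.
Qed.

Lemma price_bounded sigma tau X (c : R) : stopping_pair F sigma tau ->
  Linfty_at F tau X -> (\forall w \ae P, `|X w| <= c) ->
  \forall w \ae P, `|Pi sigma tau X w| <= c.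
Proof.
move=> st LX Xc; have [ss _ _] := st.
have [Z LZ Zc] := Linfty_at_cst c ss; have [Z' LZ' Zc'] := Linfty_at_cst (- c) ss.
have h1 := @price_le_known _ _ _ _ st LX LZ.
have h2 := @price_ge_known _ _ _ _ st LX LZ'.
have XZ : \forall w \ae P, X w <= Z w.
  by apply: filterS Xc => w; rewrite ler_norml Zc => /andP[].
have ZX : \forall w \ae P, Z' w <= X w.
  by apply: filterS Xc => w; rewrite ler_norml Zc' => /andP[].
apply: filterS2 (h1 XZ) (h2 ZX) => w; rewrite Zc Zc' ler_norml => -> ->.
by [].
Qed.

(** With c bounding X and Y, X is dominated everywhere by Y + 2 c 1_(~A); the
    last term is known at time sigma, so by translation invariance it adds to
    the price its own value, which vanishes on A. *)
Lemma price_local sigma tau X Y A : stopping_pair F sigma tau ->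
  Linfty_at F tau X -> Linfty_at F tau Y -> stopped_sigma_algebra F sigma A ->
  (\forall w \ae P, A w -> X w <= Y w) ->
  \forall w \ae P, A w -> Pi sigma tau X w <= Pi sigma tau Y w.
Proof.
move=> st LX LY FA XY; have [ss tt _] := st.
have [c c0 [Xc Yc]] := Linfty_bounded2 X Y.
have [Z LZ ZE] :=
  Linfty_at_indic (2 * c) ss (sigma_algebra_setC (SS ss) FA).
have LZ' := Linfty_at_sub st LZ.
have LYZ : Linfty_at F tau (Y + Z).
  by rewrite /Linfty_at /=; exact: measurable_funD.
have XYZ : \forall w \ae P, X w <= (Y + Z) w.
  apply: filterS3 XY Xc Yc => w XY; rewrite !ler_norml => /andP[? ?] /andP[? ?].
  rewrite (_ : (Y + Z) w = Y w + Z w)// ZE indicE.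
  case: (boolP (w \in ~` A)) => [_|]; first by rewrite mulr1; lra.
  by move=> /negP; rewrite in_setE /= => /contrapT/XY; rewrite mulr0 addr0.
have := dpp_monotone dpp st LX LYZ XYZ; have := dpp_translation dpp st LY LZ.
apply: filterS2 => w -> + Aw; rewrite ZE indicE memNset ?mulr0 ?addr0//.
Qed.

Lemma price_consistent sigma tau X : stopping_pair F sigma tau ->
  \forall w \ae P, Pi sigma timeoo (Pi tau timeoo X) w = Pi sigma timeoo X w.
Proof.
move=> st; have [ss tt _] := st.
have tto := stopping_pair_timeoo hF tt.
have LX := Linfty_at_timeoo X.
have LM := dpp_Linfty dpp tto LX.
have h1 := TCPP_time_consistent hPi st tto LX.
have h2 := TCPP_time_consistent hPi st tto (Linfty_at_timeoo (Pi tau timeoo X)).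
have h3 := price_ae_eq st (dpp_Linfty dpp tto (Linfty_at_timeoo _)) LM
  (price_known tto LM).
by apply: filterS3 h1 h2 h3 => w <- <- ->.
Qed.

(** It suffices to compare each of the two times with their minimum.  If
    sigma <= tau, then 1_A M_tau is already known at time sigma for
    A = {sigma = tau}, so pricing M_tau at time sigma leaves it unchanged on A
    by locality; and this price is M_sigma by time consistency. *)
Lemma price_eq_where_equal sigma tau X :
  stopping_time F sigma -> stopping_time F tau ->
  \forall w \ae P, sigma w = tau w ->
    Pi sigma timeoo X w = Pi tau timeoo X w.
Proof.
suff H sigma' tau' : stopping_pair F sigma' tau' ->
    \forall w \ae P, sigma' w = tau' w ->
      Pi sigma' timeoo X w = Pi tau' timeoo X w.
  move=> ss tt; have mm := stopping_time_min hF ss tt.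
  pose m w := Order.min (sigma w) (tau w).
  have ms : stopping_pair F m sigma.
    by split=> // w; rewrite /m ge_min lexx.
  have mt : stopping_pair F m tau.
    by split=> // w; rewrite /m ge_min lexx orbT.
  apply: filterS2 (H _ _ ms) (H _ _ mt) => w h1 h2 e.
  by rewrite -h1 -?h2 // /m e minxx.
move=> st; have [ss tt _] := st.
pose A := [set w | sigma' w = tau' w].
have FA : stopped_sigma_algebra F sigma' A.
  rewrite -(setTI A); apply: (stopped_setI_eq hF st).
  exact: sigma_algebra_setT (SS tt).
have tto := stopping_pair_timeoo hF tt.
set M := Pi tau' timeoo X.
have LM : Linfty_at F tau' M := dpp_Linfty dpp tto (Linfty_at_timeoo X).
have [c c0 Mc] := Linfty_bounded M.
have mMA : measurable_wrt (stopped_sigma_algebra F sigma')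
    (fun w => M w * \1_A w).
  apply/(measurable_wrtP (SS ss)) => B mB.
  move: LM => /(measurable_wrtP (SS tt))/(_ B mB)/(stopped_setI_eq hF st) FB.
  rewrite (_ : _ @^-1` B = (M @^-1` B `&` A) `|`
     (~` A `&` (cst 0 @^-1` B))).
    apply: (sigma_algebra_setU (SS ss)) => //.
    apply: (sigma_algebra_setI (SS ss)); first exact: sigma_algebra_setC (SS ss) _ FA.
    rewrite preimage_cst; case: ifP => _; last by case: (SS ss).
    exact: sigma_algebra_setT (SS ss).
  apply/seteqP; split=> w /=; rewrite indicE.
    have [Aw|nA] := pselect (A w); first by rewrite mem_set// mulr1; left.
    by rewrite memNset// mulr0; right.
  by case=> -[h1 h2]; [rewrite mem_set// mulr1|rewrite memNset// mulr0].
have [|Z ZE] := @Linfty_intro _ _ _ P (fun w => M w * \1_A w) c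
    (measurable_wrt_measurable (SS ss) (@stopped_measurable _ _ _ F sigma') mMA).
  apply: filterS Mc => w Mc; rewrite indicE; case: (_ \in _).
    by rewrite mulr1.
  by rewrite mulr0 normr0.
have LZ : Linfty_at F sigma' Z by rewrite /Linfty_at /= -ZE.
have LZ' := Linfty_at_sub st LZ.
have ZA w : A w -> Z w = M w by move=> Aw; rewrite -ZE indicE mem_set// mulr1.
have ZleM : \forall w \ae P, A w -> Z w <= M w.
  by apply: nearW => w /ZA ->.
have MleZ : \forall w \ae P, A w -> M w <= Z w.
  by apply: nearW => w /ZA ->.
have h1 := price_local st LZ' LM FA ZleM.
have h2 := price_local st LM LZ' FA MleZ.
have h3 := price_known st LZ.
have h4 := TCPP_time_consistent hPi st tto (Linfty_at_timeoo X).
apply: filterS2 (filterI h1 h2) (filterI h3 h4) => w [le1 le2] [eZ eX] Aw.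
rewrite -eX -(ZA w Aw) -eZ; apply/eqP; rewrite eq_le.
by rewrite le1 ?le2.
Qed.

(** Lowering X to - c outside the event A_n that the prices stay below M + e
    from the n-th time on makes it cost at most M + e at that time; these
    claims increase to X. *)
Lemma price_le_limit sigma (sigma_ : nat -> Omega -> \bar R) (X M : Linfty P) :
  (forall n, stopping_pair F sigma (sigma_ n)) -> Linfty_at F sigma M ->
  (\forall w \ae P, forall e, 0 < e ->
    \forall n \near \oo, Pi (sigma_ n) timeoo X w <= M w + e) ->
  \forall w \ae P, Pi sigma timeoo X w <= M w.
Proof.
move=> sp LM lim; have ss : stopping_time F sigma by case: (sp 0%N).
have sn n : stopping_time F (sigma_ n) by case: (sp n).
have soo := stopping_pair_timeoo hF ss.
have snoo n := stopping_pair_timeoo hF (sn n).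
have LX := Linfty_at_timeoo X.
have [c c0 [Xc Mc]] := Linfty_bounded2 X M.
suff H (e : R) : 0 < e -> \forall w \ae P, Pi sigma timeoo X w <= M w + e.
  have : \forall w \ae P, forall n : nat, Pi sigma timeoo X w <= M w + n.+1%:R^-1.
    by apply: ae_foralln => n; apply: H; rewrite invr_gt0.
  apply: filterS => w h; apply/ler_addgt0Pl => e e0.
  have [n ne] : exists n : nat, n.+1%:R^-1 <= e.
    exists (Num.trunc e^-1); rewrite -[leRHS]invrK lef_pV2 ?posrE ?invr_gt0//.
    by rewrite ltW// truncnS_gt.
  by rewrite addrC (le_trans (h n))// lerD2l.
move=> e0.
pose C n := [set w | Pi (sigma_ n) timeoo X w <= M w + e].
have LM' n : Linfty_at F (sigma_ n) M := Linfty_at_sub (sp n) LM.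
have LMe n : measurable_wrt (stopped_sigma_algebra F (sigma_ n))
    (fun w => M w + e : R).
  by apply: measurable_funD; [exact: LM'|exact: measurable_cst].
have FC n : stopped_sigma_algebra F (sigma_ n) (C n).
  have LPn := dpp_Linfty dpp (snoo n) LX.
  have := @measurable_fun_ler _
    (g_sigma_algebraType (stopped_sigma_algebra F (sigma_ n))) _ setT _ _
    LPn (LMe n).
  move=> /(_ measurableT [set true] I); rewrite setTI.
  by rewrite (measurable_g_measurableTypeE (SS (sn n))).
have mC n : measurable (C n) by case: (FC n).
pose A n := \bigcap_(k in [set k | (n <= k)%N]) C k.
have mA n : measurable (A n) 
  by apply: bigcap_measurable => //; exists n => /=.
have mX : measurable_fun setT X by exact: measurable_funP.
have mf n : measurable_fun setT (fun w => if w \in A n then X w else - c).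
  apply: measurable_fun_ifT => //.
    apply: (measurable_fun_bool true); rewrite setTI.
    rewrite (_ : _ @^-1` _ = A n)//.
    by apply/seteqP; split=> w; [exact: set_mem|exact: mem_set].
have Xn_ex n : exists Y : Linfty P, (fun w => if w \in A n then X w else - c) = Y.
  apply: (Linfty_intro (c := c) (mf n)).
  by apply: filterS Xc => w; case: ifP => // _ _; rewrite normrN ger0_norm.
pose X_ n := sval (cid (Xn_ex n)).
have XE n w : X_ n w = if w \in A n then X w else - c.
  by rewrite /X_; case: cid => Y /= <-.
have L_ n := Linfty_at_timeoo (X_ n).
have A_nd n : A n `<=` A n.+1 by move=> w Aw k /= /ltnW; exact: Aw.
have X_nd n : \forall w \ae P, X_ n w <= X_ n.+1 w.
  apply: filterS Xc => w; rewrite !XE ler_norml => /andP[cX _].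
  case: (boolP (w \in A n)) => [/set_mem/A_nd/mem_set ->//|_].
  by case: ifP.
have X_cvg : \forall w \ae P, X_ n w @[n --> \oo] --> X w.
  apply: filterS lim => w /(_ _ e0)[N _ Nw].
  apply: cvg_near_cst; exists N => // n /= Nn.
  rewrite XE mem_set//= => k /= nk; apply: Nw => /=.
  exact: leq_trans Nn nk.
have := TCPP_continuous_from_below hPi soo L_ LX X_nd X_cvg.
have [Z LZ ZE] : exists2 Z : Linfty P, Linfty_at F sigma Z &
    forall w, Z w = M w + e.
  have [Z LZ Ze] := Linfty_at_cst e ss.
  exists (M + Z); first by rewrite /Linfty_at /=; exact: measurable_funD.
  by move=> w; rewrite (_ : (M + Z) w = M w + Z w)// Ze.
have bound n : \forall w \ae P, Pi sigma timeoo (X_ n) w <= M w + e.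
  have [Zc LZc Zcc] := Linfty_at_cst (- c) (sn n).
  have inC : \forall w \ae P, C n w -> X_ n w <= X w.
    apply: filterS Xc => w + _; rewrite XE ler_norml => /andP[cX _].
    by case: ifP.
  have outC : \forall w \ae P, (~` C n) w -> X_ n w <= Zc w.
    apply: nearW => w nC; rewrite XE Zcc ifF//.
    by apply/negbTE/negP => /set_mem/(_ n (leqnn n)).
  have h1 := price_local (snoo n) (L_ n) LX (FC n) inC.
  have h2 := price_local (snoo n) (L_ n) (Linfty_at_timeoo Zc)
    (sigma_algebra_setC (SS (sn n)) (FC n)) outC.
  have h3 := price_known (snoo n) LZc.
  have h : \forall w \ae P, Pi (sigma_ n) timeoo (X_ n) w <= Z w.
    apply: filterS2 (filterI h1 h2) (filterI h3 Mc) => w [le1 le2] [eZ Mw].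
    rewrite ZE; have [Cw|nC] := pselect (C n w).
      exact: le_trans (le1 Cw) Cw.
    apply: (le_trans (le2 nC)); rewrite eZ Zcc.
    by move: Mw; rewrite ler_norml => /andP[? _]; lra.
  have LPn := dpp_Linfty dpp (snoo n) (L_ n).
  have h4 := price_le_known (sp n) LPn LZ h.
  have h5 := TCPP_time_consistent hPi (sp n) (snoo n) (L_ n).
  by apply: filterS2 h4 h5 => w; rewrite ZE => + <-.
have bounds := ae_foralln bound.
apply: filterS2 bounds => w bw cw; rewrite -(cvg_lim _ cw)//.
apply: limr_le; first by apply/cvg_ex; exists (Pi sigma timeoo X w).
by apply: nearW => n; exact: bw.
Qed.

End pricing.

(** * Zero penalty measures *)

Section integral_order.
Context d (Omega : measurableType d) (R : realType) (Q : probability Omega R).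
Context (A : set Omega) (f g : Omega -> R).
Hypotheses (mA : measurable A) (intf : Q.-integrable setT (EFin \o f))
  (intg : Q.-integrable setT (EFin \o g)).

Let intfA := integrableS measurableT mA (@subsetT _ A) intf.
Let intgA := integrableS measurableT mA (@subsetT _ A) intg.

Lemma ae_le_integral : (\forall w \ae Q, f w <= g w) ->
  (\int[Q]_(w in A) (f w)%:E <= \int[Q]_(w in A) (g w)%:E)%E.
Proof.
have ff : (\int[Q]_(w in A) (f w)%:E)%E \is a fin_num.
  by apply: integrable_fin_num => //; exact: intfA.
move=> fg; rewrite -sube_ge0 ?ff ?orbT//.
rewrite -integralB_EFin//.
rewrite (ae_eq_integral (fun w => `|(g w)%:E - (f w)%:E|)%E)//.
- exact: integral_ge0.
- exact: (measurable_int Q (integrableB mA intgA intfA)).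
- apply: measurableT_comp => //.
  exact: (measurable_int Q (integrableB mA intgA intfA)).
- by apply: filterS fg => w fg _; rewrite gee0_abs// sube_ge0// lee_fin.
Qed.

Lemma le_integralN :
  (\int[Q]_(w in A) (f w)%:E <= \int[Q]_(w in A) (g w)%:E)%E ->
  (\int[Q]_(w in A) (- g w)%:E <= \int[Q]_(w in A) (- f w)%:E)%E.
Proof.
move=> fg; under eq_integral do rewrite EFinN.
under [leRHS]eq_integral do rewrite EFinN.
rewrite !integralN ?leeN2//; apply: fin_num_adde_defl; rewrite fin_numN;
  by apply: integrable_fin_num => //; exact: integrable_funeneg.
Qed.

End integral_order.

Section zero_penalty_measure.
Context d (Omega : measurableType d) (R : realType) (P : probability Omega R).
Context (F : R -> set (set Omega)) (hF : usual_filtration P F).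
Context (Pi : (Omega -> \bar R) -> (Omega -> \bar R) -> Linfty P -> Linfty P).
Hypothesis hPi : TCPP F Pi.
Context (Q : probability Omega R).
Hypotheses (hQP : equivalent_probability Q P) (hQ : zero_penalty F Pi Q).
Implicit Types (sigma tau : Omega -> \bar R) (X Y Z : Linfty P).

Let dpp := TCPP_dpp hPi.
Let QP : Q `<< P := hQP.1.
Let PQ : P `<< Q := hQP.2.
Let SS sigma (s : stopping_time F sigma) := stopped_sigma_algebraP hF s.
Let Sm sigma := @stopped_measurable _ Omega R F sigma.
Let intX X := Linfty_integrable X QP.
Let st0 : stopping_time F time0.
Proof. exact: (stopping_time_cst hF). Qed.

(** The minimal penalty takes its default value +oo only if no essential
    supremum exists; vanishing excludes this, so the penalty does dominate each
    E_Q(X|F_0) - Pi_0(X), and integrating gives the inequality. *)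
Lemma zero_penalty_expectation X :
  (\int[Q]_w (X w)%:E <= \int[Q]_w (Pi time0 timeoo X w)%:E)%E.
Proof.
move: (hQ); rewrite /zero_penalty /minimal_penalty; set S := (X in xget _ X).
case: xgetP => [Z _ [mZ SZ _] Z0|noZ abs]; last first.
  have : Q.-negligible setT.
    by apply: negligibleS abs => w _ /=.
  move/(measure_negligible measurableT).
  rewrite [X in X = _](_ : _ = 1%E); last exact: probability_setT.
  by move/eqP; rewrite onee_eq0.
have le0 : \forall w \ae Q,
    cond_exp Q (stopped_sigma_algebra F time0) X w <= Pi time0 timeoo X w.
  have : \forall w \ae Q, ((cond_exp Q (stopped_sigma_algebra F time0) X w
      - Pi time0 timeoo X w)%:E <= Z w)%E.
    by apply: SZ; exists X => //; exact: Linfty_at_timeoo.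
  apply: filterS2 Z0 => w ->; rewrite lee_fin; lra.
have [_ intY YE] := cond_expP (SS st0) (@Sm time0) (intX X).
rewrite -YE; last exact: sigma_algebra_setT (SS st0).
exact: ae_le_integral.
Qed.

(** The claim W = 1_A (X - M_sigma) has a nonpositive price at time sigma, by
    locality on A and on its complement. *)
Lemma zero_penalty_integral sigma X A : stopping_time F sigma ->
  stopped_sigma_algebra F sigma A ->
  (\int[Q]_(w in A) (X w)%:E <= \int[Q]_(w in A) (Pi sigma timeoo X w)%:E)%E.
Proof.
move=> ss FA; have mA := Sm FA.
have soo := stopping_pair_timeoo hF ss.
have s0 := stopping_pair_time0 hF ss.
have LX := Linfty_at_timeoo hF X.
set M := Pi sigma timeoo X.
have LM : Linfty_at F sigma M := dpp_Linfty dpp soo LX.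
pose Y := X - M.
have YE w : Y w = X w - M w by [].
have [c c0 Yc] := Linfty_bounded Y.
have [||W WE] := @Linfty_intro _ _ _ P (fun w => Y w * \1_A w) c.
- apply: measurable_funM; first exact: measurable_funP.
  exact: measurable_indic.
- apply: filterS Yc => w Yc; rewrite indicE; case: (_ \in _).
    by rewrite mulr1.
  by rewrite mulr0 normr0.
have LNM : Linfty_at F sigma (- M).
  by rewrite /Linfty_at /=; exact: measurable_funN.
have PY : \forall w \ae P, Pi sigma timeoo Y w = 0.
  have := dpp_translation dpp soo LX LNM; apply: filterS => w ->.
  by rewrite (_ : (- M) w = - M w)// subrr.
have inA : \forall w \ae P, A w -> W w <= Y w.
  by apply: nearW => w Aw; rewrite -WE indicE mem_set// mulr1.
have outA : \forall w \ae P, (~` A) w -> W w <= (0 : Linfty P) w.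
  by apply: nearW => w nA; rewrite -WE indicE memNset// mulr0.
have h1 := price_local hF hPi soo (Linfty_at_timeoo hF W)
  (Linfty_at_timeoo hF Y) FA inA.
have h2 := price_local hF hPi soo (Linfty_at_timeoo hF W)
  (Linfty_at_timeoo hF (0 : Linfty P)) (sigma_algebra_setC (SS ss) FA) outA.
have h3 := dpp_normalized dpp soo.
have [N LN NE] := @Linfty_at_cst _ _ _ P F time0 0 st0.
have PW : \forall w \ae P, Pi sigma timeoo W w <= N w.
  apply: filterS2 (filterI h1 h2) (filterI h3 PY) => w [le1 le2] [e1 e2].
  rewrite NE; have [Aw|nA] := pselect (A w); first by rewrite -e2 le1.
  by rewrite -e1 le2.
have LPW : Linfty_at F sigma (Pi sigma timeoo W).
  exact: (dpp_Linfty dpp soo (Linfty_at_timeoo hF W)).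
have h4 := price_le_known hF hPi s0 LPW LN PW.
have h5 := TCPP_time_consistent hPi s0 soo (Linfty_at_timeoo hF W).
have h6 : \forall w \ae Q, Pi time0 timeoo W w <= N w.
  by apply: (null_dominates_ae QP); apply: filterS2 h4 h5 => w + <-.
have IW : (\int[Q]_w (W w)%:E <= 0)%E.
  apply: (le_trans (zero_penalty_expectation W)).
  apply: (le_trans (ae_le_integral measurableT (intX _) (intX _) h6)).
  by rewrite (eq_integral (cst 0%E)) ?integral0// => w _; rewrite NE.
move: IW; rewrite (_ : \int[Q]_w (W w)%:E = \int[Q]_(w in A) (Y w)%:E)%E.
  under eq_integral do rewrite YE EFinB.
  rewrite integralB_EFin//; [|exact: (integrableS measurableT) (intX _)..].
  rewrite sube_le0//.
rewrite [RHS]integral_mkcond; apply: eq_integral => w _.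
rewrite -WE /patch indicE; case: ifP => _; first by rewrite mulr1.
by rewrite mulr0.
Qed.

Lemma price_integral_nonincreasing sigma tau X A : stopping_pair F sigma tau ->
  stopped_sigma_algebra F sigma A ->
  (\int[Q]_(w in A) (Pi tau timeoo X w)%:E <=
   \int[Q]_(w in A) (Pi sigma timeoo X w)%:E)%E.
Proof.
move=> st FA; have [ss _ _] := st.
apply: (le_trans (zero_penalty_integral _ ss FA)).
apply: ae_le_integral (intX _) (intX _) _; first exact: Sm FA.
apply: (null_dominates_ae QP); have := price_consistent hF hPi X st.
by apply: filterS => w ->.
Qed.

End zero_penalty_measure.

(** * Regularization of the price process *)

Lemma dyadic_above_right_cvg (R : realType) (r : R) : 0 <= r ->
  dyadic_above n r @[n --> \oo] --> within (@dyadic R) r^'+.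
Proof.
move=> r0 A [e /= e0 eA].
have /cvgrPdist_lt /(_ e e0) := dyadic_above_cvg r0.
apply: filterS => n rn; apply: (eA _ rn); first exact: dyadic_above_gt.
exact: dyadic_above_dyadic.
Qed.

Definition dyadic_enum (R : realType) (n : nat) : R :=
  if (unpickle n : option (nat * nat)) is Some (k, j) then k%:R / 2 ^+ j else 0.

Lemma range_dyadic_enum (R : realType) : range (@dyadic_enum R) = @dyadic R.
Proof.
apply/seteqP; split=> [_ [n _ <-]|_ [k [j ->]]].
  rewrite /dyadic_enum; case: unpickle => [[k j]|]; first by exists k, j.
  by exists 0%N, 0%N; rewrite mul0r.
by exists (pickle (k, j)) => //; rewrite /dyadic_enum pickleK.
Qed.

Section regularization.
Context d (Omega : measurableType d) (R : realType) (P : probability Omega R).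
Context (F : R -> set (set Omega)) (hF : usual_filtration P F).
Context (Pi : (Omega -> \bar R) -> (Omega -> \bar R) -> Linfty P -> Linfty P).
Hypothesis hPi : TCPP F Pi.
Context (Q : probability Omega R).
Hypotheses (hQP : equivalent_probability Q P) (hQ : zero_penalty F Pi Q).
Context (X : Linfty P) (c : R).
Hypotheses (c0 : 0 <= c) (Xc : \forall w \ae P, `|X w| <= c).

Let dpp := TCPP_dpp hPi.
Let QP : Q `<< P := hQP.1.
Let PQ : P `<< Q := hQP.2.
Let SS sigma (s : stopping_time F sigma) := stopped_sigma_algebraP hF s.
Let intX Y := @Linfty_integrable _ _ _ P Q Y QP.
Let M sigma : Linfty P := Pi sigma timeoo X.

Let M_at sigma : stopping_time F sigma -> Linfty_at F sigma (M sigma).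
Proof.
move=> ss; apply: (dpp_Linfty dpp (stopping_pair_timeoo hF ss)).
exact: Linfty_at_timeoo.
Qed.

Let M_bounded sigma : stopping_time F sigma ->
  \forall w \ae P, `|M sigma w| <= c.
Proof.
move=> ss; apply: (price_bounded hF hPi (stopping_pair_timeoo hF ss)) => //.
exact: Linfty_at_timeoo.
Qed.

(** The prices shifted by c, so as to be nonnegative, and clipped, so that the
    bounds hold for every outcome and not just almost surely. *)
Let p (t : R) w : R :=
  Num.max 0 (Num.min (2 * c) (M (cst t%:E) w + c)).

Let p_ge0 t w : 0 <= p t w. Proof. by rewrite le_max lexx. Qed.

Let p_le t w : `|p t w| <= 2 * c.
Proof.
rewrite ger0_norm ?p_ge0// ge_max ge_min lexx andbT /=.
by rewrite mulr_ge0.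
Qed.

Let pE t : 0 <= t -> \forall w \ae P, p t w = M (cst t%:E) w + c.
Proof.
move=> t0; have ss := @stopping_time_cst _ _ _ P F hF t%:E t0.
apply: filterS (M_bounded ss) => w; rewrite ler_norml => /andP[lo hi].
by rewrite /p min_r ?max_r//; lra.
Qed.

Let p_measurable t : 0 <= t -> measurable_wrt (F t) (p t).
Proof.
move=> t0; have ss := @stopping_time_cst _ _ _ P F hF t%:E t0.
have mM : measurable_wrt (F t) (M (cst t%:E)).
  exact: (measurable_wrt_sub (SS ss) (filtration_sigma_algebra hF t0)
    (stopped_cst_sub t0) (M_at ss)).
apply: measurable_maxr; first exact: measurable_cst.
apply: measurable_minr; first exact: measurable_cst.
by apply: measurable_funD => //; exact: measurable_cst.
Qed.

Let p_integral t A : 0 <= t -> measurable A ->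
  (\int[Q]_(w in A) (p t w)%:E =
   \int[Q]_(w in A) (M (cst t%:E) w)%:E + \int[Q]_(w in A) c%:E)%E.
Proof.
move=> t0 mA; rewrite -integralD//; last 2 first.
- exact: integrableS (intX _).
- exact: finite_measure_integrable_cst.
apply: ae_eq_integral => //.
- apply/measurable_EFinP/measurable_funTS.
  exact: measurable_wrt_measurable (filtration_sigma_algebra hF t0)
    (filtration_measurable hF t0) _ _ _ (p_measurable t0).
- by apply/measurable_EFinP/measurable_funTS/measurable_funD.
- apply: (null_dominates_ae QP); apply: filterS (pE t0) => w -> _.
  by rewrite EFinD.
Qed.

Let p_super s t A : 0 <= s -> s <= t -> F s A ->
  (\int[Q]_(w in A) (p t w)%:E <= \int[Q]_(w in A) (p s w)%:E)%E.
Proof.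
move=> s0 st FA; have t0 := le_trans s0 st.
have mA := filtration_measurable hF s0 FA.
rewrite !p_integral// leeD2r//.
apply: (price_integral_nonincreasing hF hPi hQP hQ); last first.
  exact: stopped_cst hF _ s0 _ FA.
by split=> //; exact: (stopping_time_cst hF).
Qed.

Let good := [set w | bounded_upcross (@dyadic R) (p^~ w)].

Let ae_good : \forall w \ae P, good w.
Proof.
apply: (null_dominates_ae PQ); rewrite /good -range_dyadic_enum.
have e0 n : 0 <= @dyadic_enum R n.
  by apply: dyadic_ge0; rewrite -range_dyadic_enum; exists n.
exact: (ae_bounded_upcross (filtration_sigma_algebra hF)
  (filtration_measurable hF) (filtration_nondecreasing hF)
  p_ge0 p_measurable p_super e0).
Qed.

(** Right limits along the dyadics, with the shift by c undone; the null
    event of bad paths receives the zero path. *)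
Definition price_modification (x : \bar R) (w : Omega) : R :=
  if w \in good then
    if x is t%:E then lim (p^~ w @ within (@dyadic R) t^'+) - c else X w
  else 0.

Let Y := price_modification.

Lemma price_modification_cadlag w : cadlag (fun t => Y t%:E w).
Proof.
rewrite /Y /price_modification; case: (boolP (w \in good)) => [/set_mem gw|_].
  have [rc lc] := cadlag_right_limits (@dyadic_dense R) (p_le^~ w) gw.
  split=> t t0; first by apply: cvgB; [exact: rc|exact: cvg_cst].
  by apply: is_cvgB; [exact: lc|exact: is_cvg_cst].
by split=> t t0; [exact: cvg_cst|exact: is_cvg_cst].
Qed.

Section at_stopping_time.
Context (sigma : Omega -> \bar R).
Hypothesis ss : stopping_time F sigma.

Let sigma_ n : Omega -> \bar R := @edyadic_above R n \o sigma.

Let sn n : stopping_time F (sigma_ n).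
Proof. exact: stopping_time_dyadic hF _ n ss. Qed.

Let sigma_pair n : stopping_pair F sigma (sigma_ n).
Proof.
split=> // w; rewrite /sigma_ /=; case: ss => /(_ w) + _.
case: (sigma w) => [r| |] //= _.
by rewrite lee_fin ltW// dyadic_above_gt.
Qed.

Let sigma_nonincr n m : (n <= m)%N -> stopping_pair F (sigma_ m) (sigma_ n).
Proof.
move=> nm; split=> // w; rewrite /sigma_ /=; case: ss => /(_ w) + _.
case: (sigma w) => [r| |] //=; rewrite !lee_fin => r0.
have /nonincreasing_seqP : forall k, dyadic_above k.+1 r <= dyadic_above k r.
  by move=> k; exact: dyadic_aboveS.
exact.
Qed.

Let price_dyadic_cvg :
  \forall w \ae P, M (sigma_ n) w @[n --> \oo] --> Y (sigma w) w.
Proof.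
have eqfin : \forall w \ae P, forall n k : nat,
    sigma_ n w = (@dyadic_enum R k)%:E -> M (sigma_ n) w = p (@dyadic_enum R k) w - c.
  apply: ae_foralln => n; apply: ae_foralln => k.
  have k0 : 0 <= @dyadic_enum R k.
    by apply: (@dyadic_ge0 R); rewrite -range_dyadic_enum; exists k.
  have sk := @stopping_time_cst _ _ _ P F hF (@dyadic_enum R k)%:E k0.
  have := price_eq_where_equal hF hPi X (sn n) sk.
  apply: filterS2 (pE k0) => w -> h e.
  by rewrite /M h// addrK.
have soo : stopping_time F timeoo by apply: (stopping_time_cst hF).
have eqinf : \forall w \ae P, forall n, sigma_ n w = +oo%E -> M (sigma_ n) w = X w.
  apply: ae_foralln => n.
  have := price_eq_where_equal hF hPi X (sn n) soo.
  have := price_known hPi (stopping_pair_timeoo hF soo) (Linfty_at_timeoo hF X).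
  by apply: filterS2 => w h1 h2 e; rewrite /M h2.
apply: filterS3 ae_good eqfin eqinf => w gw fin inf.
rewrite /Y /price_modification mem_set//.
case sE : (sigma w) => [r| |].
- have r0 : 0 <= r by case: ss => /(_ w) + _; rewrite sE.
  have -> : (fun n => M (sigma_ n) w) = (fun n => p (dyadic_above n r) w - c).
    apply/funext => n.
    have : dyadic (dyadic_above n r) by exact: dyadic_above_dyadic.
    rewrite -range_dyadic_enum => -[k _ kE].
    by rewrite (fin n k) ?kE// /sigma_ /= sE /=.
  apply: cvgB; last exact: cvg_cst.
  have cv := cvg_within_right (@dyadic_dense R) (p_le^~ w) gw r0.
  exact: (cvg_comp _ _ (dyadic_above_right_cvg r0) cv).
- have -> : (fun n => M (sigma_ n) w) = (fun=> X w).
    by apply/funext => n; rewrite inf// /sigma_ /= sE.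
  exact: cvg_cst.
- by case: ss => /(_ w) + _; rewrite sE.
Qed.

(** Y_sigma is a limit of variables known at the times sigma_n, n >= m, hence
    known at each time sigma_m. *)
Let Y_measurable :
  measurable_wrt (stopped_sigma_algebra F sigma) (fun w => Y (sigma w) w).
Proof.
have Ym m : measurable_wrt (stopped_sigma_algebra F (sigma_ m))
    (fun w => Y (sigma w) w).
  apply: (measurable_wrt_cvg (SS (sn m))
    (fun N nN => stopped_null hF (sigma_ m) nN)
    (f_ := fun n => M (sigma_ (n + m)%N))).
  - move=> n; have nm := sigma_nonincr (leq_addl n m).
    exact: (Linfty_at_sub hF nm (M_at (sn _))).
  - apply: filterS price_dyadic_cvg => w.
    by rewrite -(cvg_shiftn m).
apply/(measurable_wrtP (SS ss)) => B mB.
apply: (stopped_right_continuous hF (sigma_ := sigma_)) => //.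
  move=> w s t st; rewrite /sigma_ /=; case: ss => /(_ w) + _.
  case: (sigma w) => [r| |] //; rewrite !lee_fin => r0 rs.
  have rt : r < t by lra.
  have /cvgr_lt /(_ t rt) [n _ /(_ n (leqnn n)) /= nt] := dyadic_above_cvg r0.
  by exists n; rewrite lee_fin ltW.
by move=> n; have /(measurable_wrtP (SS (sn n))) := Ym n; exact.
Qed.

Lemma price_modificationE : \forall w \ae P, M sigma w = Y (sigma w) w.
Proof.
have Mnc : \forall w \ae P, forall n, `|M (sigma_ n) w| <= c.
  by apply: ae_foralln => n; exact: M_bounded.
have Yc : \forall w \ae P, `|Y (sigma w) w| <= c.
  apply: filterS2 Mnc price_dyadic_cvg => w Mc cv.
  have cn : `|M (sigma_ n) w| @[n --> \oo] --> `|Y (sigma w) w| by exact: cvg_norm.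
  rewrite -(cvg_lim _ cn)//.
  by apply: limr_le; [apply/cvg_ex; eexists; exact: cn|exact: nearW].
have [|Z ZE] := @Linfty_intro _ _ _ P (fun w => Y (sigma w) w) c _ Yc.
  exact: measurable_wrt_measurable (SS ss) (@stopped_measurable _ _ _ F sigma)
    _ _ _ Y_measurable.
have ZY w : Z w = Y (sigma w) w by rewrite -ZE.
have LZ : Linfty_at F sigma Z by rewrite /Linfty_at /= -ZE; exact: Y_measurable.
have le1 : \forall w \ae P, M sigma w <= Z w.
  apply: (price_le_limit hF hPi sigma_pair LZ).
  apply: filterS price_dyadic_cvg => w cv e e0.
  rewrite ZY; have Ye : Y (sigma w) w < Y (sigma w) w + e by lra.
  by have /cvgr_lt /(_ _ Ye) := cv; apply: filterS => n; exact: ltW.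
have le2 : \forall w \ae P, Z w <= M sigma w.
  apply: (null_dominates_ae PQ).
  apply: (ae_le_integral_events (SS ss) (@stopped_measurable _ _ _ F sigma)
    LZ (M_at ss) (intX _) (intX _)) => A FA.
  have mA := @stopped_measurable _ _ _ F sigma A FA.
  have [] := @dominated_convergence _ _ _ Q A mA
    (fun n w => (M (sigma_ n) w)%:E) (fun w => (Z w)%:E) (cst c%:E).
  - by move=> n; apply/measurable_EFinP/measurable_funTS.
  - by apply/measurable_EFinP/measurable_funTS.
  - apply: (null_dominates_ae QP); apply: filterS price_dyadic_cvg => w cv _.
    by rewrite ZY; apply: cvg_EFin => //; exact: nearW.
  - exact: finite_measure_integrable_cst.
  - by apply: (null_dominates_ae QP); apply: filterS Mnc => w h n _; exact: h.
  move=> _ _ cv; rewrite -(cvg_lim _ cv)//.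
  apply: lime_le; first by apply/cvg_ex; eexists; exact: cv.
  apply: nearW => n.
  exact: (price_integral_nonincreasing hF hPi hQP hQ X (sigma_pair n) FA).
apply: filterS2 le1 le2 => w h1 h2; rewrite -ZY.
by apply/eqP; rewrite eq_le h1 h2.
Qed.

End at_stopping_time.

Lemma price_has_cadlag_modification : has_cadlag_modification P F M.
Proof.
exists Y; split.
- exact: price_modification_cadlag.
- move=> t t0; have st := @stopping_time_cst _ _ _ P F hF t t0.
  apply: (measurable_wrt_ae (SS st)
    (fun N nN => stopped_null hF (cst t) nN) (M_at st)).
  exact: price_modificationE st.
- by move=> sigma ss; exact: price_modificationE.
Qed.

End regularization.

(** * Price bounds and regular supermartingales *)

Theorem proposition2p3 (d : measure_display) (Omega : measurableType d)
    (R : realType) (P : probability Omega R) (F : R -> set (set Omega))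
    (hF : usual_filtration P F)
    (Pi : (Omega -> \bar R) -> (Omega -> \bar R) -> Linfty P -> Linfty P)
    (hPi : TCPP F Pi) (hNFL : no_free_lunch Pi)
    (X : Linfty P) (Q : probability Omega R)
    (hQP : equivalent_probability Q P) (hQ : zero_penalty F Pi Q) :
  [/\ supermartingale Q F (fun sigma => Pi sigma timeoo X : Omega -> R) /\
      has_cadlag_modification P F
        (fun sigma => Pi sigma timeoo X : Omega -> R),
      submartingale Q F (fun sigma w => - Pi sigma timeoo (- X) w) /\
      has_cadlag_modification P F
        (fun sigma w => - Pi sigma timeoo (- X) w) &
      forall sigma, stopping_time F sigma ->
        \forall w \ae P,
          - Pi sigma timeoo (- X) w
            <= cond_exp Q (stopped_sigma_algebra F sigma) X w
            <= Pi sigma timeoo X w].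
Proof.
have [QP PQ] := hQP; have dpp := TCPP_dpp hPi.
have SS sigma (ss : stopping_time F sigma) := stopped_sigma_algebraP hF ss.
have Sm sigma := @stopped_measurable _ Omega R F sigma.
have intX (Y : Linfty P) := Linfty_integrable Y QP.
have intN (Y : Linfty P) : Q.-integrable setT (EFin \o (fun w => - Y w)).
  exact: (intX (- Y)).
have meas (Y : Linfty P) sigma : stopping_time F sigma ->
    measurable_wrt (stopped_sigma_algebra F sigma) (Pi sigma timeoo Y).
  move=> ss; apply: (dpp_Linfty dpp (stopping_pair_timeoo hF ss)).
  exact: Linfty_at_timeoo.
have measN (Y : Linfty P) sigma : stopping_time F sigma ->
    measurable_wrt (stopped_sigma_algebra F sigma)
      (fun w => - Pi sigma timeoo Y w).
  by move=> ss; apply: measurable_funN; exact: meas.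
have cadlagX (Y : Linfty P) : has_cadlag_modification P F
    (fun sigma => Pi sigma timeoo Y : Omega -> R).
  have [c c0 Yc] := Linfty_bounded Y.
  exact: (price_has_cadlag_modification hF hPi hQP hQ c0 Yc).
split.
- split=> //; split=> [sigma ss|sigma tau st]; first by split; [exact: meas|].
  have [ss _ _] := st.
  have [mE iE EE] := cond_expP (SS _ ss) (@Sm sigma) (intX (Pi tau timeoo X)).
  apply: (ae_le_integral_events (SS _ ss) (@Sm sigma) mE (meas X _ ss) iE (intX _)).
  move=> A FA; rewrite EE//.
  exact: (price_integral_nonincreasing hF hPi hQP hQ).
- split.
    split=> [sigma ss|sigma tau st]; first by split; [exact: measN|exact: intN].
    have [ss _ _] := st.
    have [mE iE EE] := cond_expP (SS _ ss) (@Sm sigma) (intN (Pi tau timeoo (- X))).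
    apply: (ae_le_integral_events (SS _ ss) (@Sm sigma) (measN _ _ ss) mE (intN _) iE).
    move=> A FA; rewrite EE//; apply: le_integralN => //; first exact: Sm FA.
    exact: (price_integral_nonincreasing hF hPi hQP hQ).
  have [Y [Ycadlag Ymeas YE]] := cadlagX (- X).
  exists (fun t w => - Y t w); split.
  + move=> w; have [rc lc] := Ycadlag w.
    by split=> t t0; [apply: cvgN; exact: rc|apply: is_cvgN; exact: lc].
  + by move=> t t0; apply: measurable_funN; exact: Ymeas.
  + by move=> sigma ss; apply: filterS (YE _ ss) => w ->.
- move=> sigma ss.
  have [mE iE EE] := cond_expP (SS _ ss) (@Sm sigma) (intX X).
  apply: (null_dominates_ae PQ).
  have lo : \forall w \ae Q, - Pi sigma timeoo (- X) w <=
      cond_exp Q (stopped_sigma_algebra F sigma) X w.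
    apply: (ae_le_integral_events (SS _ ss) (@Sm sigma) (measN _ _ ss) mE (intN _) iE).
    move=> A FA; rewrite EE//.
    have := le_integralN (Sm _ _ FA) (intX (- X)) (intX (Pi sigma timeoo (- X)))
      (zero_penalty_integral hF hPi hQP hQ (- X) ss FA).
    move=> /le_trans; apply; rewrite le_eqVlt; apply/orP; left; apply/eqP.
    by apply: eq_integral => w _; rewrite (_ : (- X) w = - X w)// opprK.
  have hi : \forall w \ae Q, cond_exp Q (stopped_sigma_algebra F sigma) X w
      <= Pi sigma timeoo X w.
    apply: (ae_le_integral_events (SS _ ss) (@Sm sigma) mE (meas X _ ss) iE (intX _)).
    move=> A FA; rewrite EE//.
    exact: (zero_penalty_integral hF hPi hQP hQ).
  by apply: filterS2 lo hi => w -> ->.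
Qed.
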